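(* Let $\Omega$ be a bounded simply connected domain in $\mathbb{C}$. For $\alpha\in(-1,0)$, we have $$\|[T_z^*,T_z]\|_{A^2_\alpha(\Omega)} \geq \frac{\rho_{\Omega,\alpha}}{\int_\Omega w_\alpha\,dx\,dy},$$ where the norm on the left is the operator norm on $A^2_\alpha(\Omega)$ and $\rho_{\Omega,\alpha}$ is the weighted torsional rigidity of $\Omega$.
   Context: Let $\phi:\Omega\to\mathbb{D}$ be the Riemann mapping of $\Omega$ (a univalent analytic map onto the open unit disc $\mathbb{D}$), and put $$w_\alpha(z) = (1+\alpha)\frac{(1-|\phi(z)|^2)^\alpha}{|\phi'(z)|^\alpha},\qquad dA_\alpha = w_\alpha\,\frac{dx\,dy}{\pi}.$$ $A^2_\alpha(\Omega)$ is the closure of the holomorphic functions on $\Omega$ in the norm $\|f\|_\alpha^2=\int_\Omega |f|^2\,dA_\alpha$, and $P:L^2_\alpha(\Omega)=L^2(\Omega,dA_\alpha)\to A^2_\alpha(\Omega)$ is the orthogonal projection. $T_z f=P(zf)$ is the Toeplitz operator on $A^2_\alpha(\Omega)$ with symbol $z$, $T_z^*$ is its adjoint, and $[T_z^*,T_z]=T_z^*T_z-T_zT_z^*$. Write $\partial=(\partial_x-i\partial_y)/2$, $\bar\partial=(\partial_x+i\partial_y)/2$ and $\Delta_\alpha = 4\,\bar\partial\,\frac{1}{w_\alpha}\,\partial$. Let $v$ be the solution of the Dirichlet problem $$\Delta_\alpha v=-2 \ \text{ in } \Omega,\qquad v|_{\partial\Omega}=0.$$ The weighted torsional rigidity is defined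 by $$\rho_{\Omega,\alpha}=2\int_\Omega v\,dx\,dy.$$ *)

(* Defs.v *)
From HB Require Import structures.
From mathcomp Require Import all_boot all_order all_algebra complex.
From mathcomp Require Import all_classical all_reals all_analysis.
Set Implicit Arguments.
Unset Strict Implicit.
Unset Printing Implicit Defensive.
Import Order.TTheory GRing.Theory Num.Theory.
Import numFieldNormedType.Exports.
Export numFieldNormedType.Exports.
Local Open Scope classical_set_scope.
Local Open Scope complex_scope.
Local Open Scope ring_scope.

(* The plane is R[i]^o, the complex numbers as a normed module over           *)
(* themselves, so that derive1 and derivable are the complex derivative and   *)
(* complex differentiability.                                                 *)

Definition cmod (R : realType) (z : R[i]^o) : R := ComplexField.Normc.normc z.

Definition is_domain (R : realType) (Om : set R[i]^o) : Prop :=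
  [/\ Om !=set0, open Om & connected Om].

(* Every loop in Om contracts, with fixed base point, to a constant loop.     *)
Definition simply_connected (R : realType) (Om : set R[i]^o) : Prop :=
  forall gamma : R -> R[i]^o,
    {within `[0, 1]%classic, continuous gamma} ->
    (forall t, t \in `[0, 1] -> Om (gamma t)) ->
    gamma 0 = gamma 1 ->
    exists H : R * R -> R[i]^o,
      [/\ {within `[0, 1]%classic `*` `[0, 1]%classic, continuous H},
          forall s t, s \in `[0, 1] -> t \in `[0, 1] -> Om (H (s, t)),
          forall t, t \in `[0, 1] -> H (0, t) = gamma t,
          forall t, t \in `[0, 1] -> H (1, t) = gamma 0 &
          forall s, s \in `[0, 1] -> H (s, 0) = gamma 0 /\ H (s, 1) = gamma 0].

Definition holomorphic (R : realType) (Om : set R[i]^o)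
    (f : R[i]^o -> R[i]^o) : Prop :=
  forall z, Om z -> derivable f z 1.

Definition is_riemann_map (R : realType) (Om : set R[i]^o)
    (phi : R[i]^o -> R[i]^o) : Prop :=
  [/\ holomorphic Om phi,
      forall z1 z2, Om z1 -> Om z2 -> phi z1 = phi z2 -> z1 = z2 &
      phi @` Om = [set z | cmod z < 1]].

Definition weight (R : realType) (alpha : R) (phi : R[i]^o -> R[i]^o)
    (z : R[i]^o) : R :=
  (1 + alpha) * ((1 - cmod (phi z) ^+ 2) `^ alpha)
    / (cmod (derive1 phi z) `^ alpha).

(* Area integrals: dx dy is the product Lebesgue measure on R * R, and (x, y) *)
(* is identified with x + iy.                                                 *)
Definition of_xy (R : realType) (p : R * R) : R[i]^o := p.1 +i* p.2.

Definition area_integral (R : realType) (Om : set R[i]^o)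
    (F : R[i]^o -> \bar R) : \bar R :=
  (\int[(@lebesgue_measure R \x @lebesgue_measure R)]_(p in @of_xy R @^-1` Om)
     F (of_xy p))%E.

Definition area_cintegral (R : realType) (Om : set R[i]^o)
    (f : R[i]^o -> R[i]^o) : R[i] :=
  fine (area_integral Om (fun z => (complex.Re (f z))%:E)) +i*
  fine (area_integral Om (fun z => (complex.Im (f z))%:E)).

(* The spaces L^2(Om, w dx dy / pi) and A^2.  Elements are represented by     *)
(* functions; two functions that agree almost everywhere on Om are            *)
(* indistinguishable for all the notions below.                               *)
Definition wnorm2 (R : realType) (Om : set R[i]^o) (w : R[i]^o -> R)
    (f : R[i]^o -> R[i]^o) : \bar R :=
  area_integral Om (fun z => (cmod (f z) ^+ 2 * (w z / pi))%:E).

Definition wnorm (R : realType) (Om : set R[i]^o) (w : R[i]^o -> R)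
    (f : R[i]^o -> R[i]^o) : R :=
  Num.sqrt (fine (wnorm2 Om w f)).

Definition winner (R : realType) (Om : set R[i]^o) (w : R[i]^o -> R)
    (f g : R[i]^o -> R[i]^o) : R[i] :=
  area_cintegral Om (fun z => f z * (g z)^*%C * (w z / pi)%:C).

Definition L2w (R : realType) (Om : set R[i]^o) (w : R[i]^o -> R)
    (f : R[i]^o -> R[i]^o) : Prop :=
  [/\ measurable_fun (@of_xy R @^-1` Om) (fun p => complex.Re (f (of_xy p))),
      measurable_fun (@of_xy R @^-1` Om) (fun p => complex.Im (f (of_xy p))) &
      (wnorm2 Om w f < +oo)%E].

Definition A2w (R : realType) (Om : set R[i]^o) (w : R[i]^o -> R)
    (f : R[i]^o -> R[i]^o) : Prop :=
  L2w Om w f /\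
  forall eps : R, 0 < eps ->
    exists h, [/\ holomorphic Om h, L2w Om w h & wnorm Om w (f \- h) < eps].

Definition is_A2proj (R : realType) (Om : set R[i]^o) (w : R[i]^o -> R)
    (f g : R[i]^o -> R[i]^o) : Prop :=
  A2w Om w g /\ forall h, A2w Om w h -> winner Om w (f \- g) h = 0.

(* xget selects a representative; its class modulo almost everywhere equality *)
(* is unique.                                                                 *)
Definition A2proj (R : realType) (Om : set R[i]^o) (w : R[i]^o -> R)
    (f : R[i]^o -> R[i]^o) : R[i]^o -> R[i]^o :=
  xget (fun=> 0) [set g | is_A2proj Om w f g].

Definition toeplitz (R : realType) (Om : set R[i]^o) (w : R[i]^o -> R)
    (u f : R[i]^o -> R[i]^o) : R[i]^o -> R[i]^o :=
  A2proj Om w (fun z => u z * f z).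

Definition A2adjoint (R : realType) (Om : set R[i]^o) (w : R[i]^o -> R)
    (S : (R[i]^o -> R[i]^o) -> (R[i]^o -> R[i]^o))
    (f : R[i]^o -> R[i]^o) : R[i]^o -> R[i]^o :=
  xget (fun=> 0)
    [set g | A2w Om w g /\
             forall h, A2w Om w h -> winner Om w (S h) f = winner Om w h g].

Definition self_commutator (R : realType) (Om : set R[i]^o) (w : R[i]^o -> R)
    (S : (R[i]^o -> R[i]^o) -> (R[i]^o -> R[i]^o))
    (f : R[i]^o -> R[i]^o) : R[i]^o -> R[i]^o :=
  A2adjoint Om w S (S f) \- S (A2adjoint Om w S f).

Definition A2opnorm (R : realType) (Om : set R[i]^o) (w : R[i]^o -> R)
    (S : (R[i]^o -> R[i]^o) -> (R[i]^o -> R[i]^o)) : \bar R :=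
  ereal_sup [set (wnorm Om w (S f))%:E |
             f in [set f | A2w Om w f /\ wnorm Om w f <= 1]].

(* Real directional derivative of a complex-valued function along e. *)
Definition dir_derivable (R : realType) (e : R[i]) (f : R[i]^o -> R[i]^o)
    (z : R[i]^o) : Prop :=
  derivable (fun t : R => complex.Re (f (z + t%:C * e))) 0 1 /\
  derivable (fun t : R => complex.Im (f (z + t%:C * e))) 0 1.

Definition dir_derive (R : realType) (e : R[i]) (f : R[i]^o -> R[i]^o)
    (z : R[i]^o) : R[i]^o :=
  derive1 (fun t : R => complex.Re (f (z + t%:C * e))) 0 +i*
  derive1 (fun t : R => complex.Im (f (z + t%:C * e))) 0.

Definition dx (R : realType) (f : R[i]^o -> R[i]^o) : R[i]^o -> R[i]^o :=
  dir_derive 1 f.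
Definition dy (R : realType) (f : R[i]^o -> R[i]^o) : R[i]^o -> R[i]^o :=
  dir_derive (0 +i* 1) f.

Definition del (R : realType) (f : R[i]^o -> R[i]^o) (z : R[i]^o) : R[i]^o :=
  (dx f z - (0 +i* 1) * dy f z) / 2.
Definition delbar (R : realType) (f : R[i]^o -> R[i]^o) (z : R[i]^o) : R[i]^o :=
  (dx f z + (0 +i* 1) * dy f z) / 2.

(* Functions of class C^k, in the real sense, on the open set U. *)
Fixpoint class_C (R : realType) (k : nat) (U : set R[i]^o)
    (f : R[i]^o -> R[i]^o) : Prop :=
  match k with
  | 0 => forall z, U z -> {for z, continuous f}
  | j.+1 =>
      [/\ forall z, U z -> dir_derivable 1 f z /\ dir_derivable (0 +i* 1) f z,
          class_C j U (dx f) & class_C j U (dy f)]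
  end.

(* C_c^infty(Om) *)
Definition test_function (R : realType) (Om : set R[i]^o)
    (f : R[i]^o -> R[i]^o) : Prop :=
  (forall k, class_C k setT f) /\
  exists K : set R[i]^o,
    [/\ compact K, K `<=` Om & forall z, ~ K z -> f z = 0].

Definition wflux (R : realType) (w : R[i]^o -> R) (f : R[i]^o -> R[i]^o)
    (z : R[i]^o) : R[i]^o :=
  (w z)^-1%:C * del f z.

Definition wlaplacian (R : realType) (w : R[i]^o -> R) (f : R[i]^o -> R[i]^o)
    (z : R[i]^o) : R[i]^o :=
  4 * delbar (wflux w f) z.

(* Zero Dirichlet data in the energy sense: v belongs to the closure of       *)
(* C_c^infty(Om) for the L^1 norm together with the energy form               *)
(* int_Om |del f|^2 / w of the operator.  No regularity of the boundary is    *)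
(* assumed, and this is the sense in which the Dirichlet problem is           *)
(* well-posed.  If w is integrable, Cauchy-Schwarz bounds the L^1 norm of     *)
(* del f by the energy, hence that of a test function f; the L^1 term is then *)
(* redundant.                                                                 *)
Definition zero_on_boundary (R : realType) (Om : set R[i]^o) (w : R[i]^o -> R)
    (v : R[i]^o -> R[i]^o) : Prop :=
  forall eps : R, 0 < eps ->
    exists f, [/\ test_function Om f,
      (area_integral Om (fun z => (cmod (v z - f z))%:E) < eps%:E)%E &
      (area_integral Om
         (fun z => (cmod (del v z - del f z) ^+ 2 / w z)%:E) < eps%:E)%E].

(* The first-order part of the operator has complex coefficients, so that the *)
(* solution is complex-valued in general.  As w is smooth and positive, the   *)
(* two regularity clauses amount to v being of class C^2 on Om.               *)
Definition dirichlet_solution (R : realType) (Om : set R[i]^o)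
    (w : R[i]^o -> R) (v : R[i]^o -> R[i]^o) : Prop :=
  [/\ class_C 1 Om v, class_C 1 Om (wflux w v),
      forall z, Om z -> wlaplacian w v z = - 2 &
      zero_on_boundary Om w v].

(* For a solution v of the Dirichlet problem the integral of v is real, being *)
(* equal to int_Om 2 |del v|^2 / w; Re only turns it into an element of R.    *)
Definition torsional_rigidity (R : realType) (Om : set R[i]^o)
    (v : R[i]^o -> R[i]^o) : R :=
  2 * complex.Re (area_cintegral Om v).

(* Main.v *)
(* Let [g = w^-1 del v] be the flux of the solution and [V] the integral of    *)
(* [v].  Since [delbar g = -1/2], Green's formula against test functions that  *)
(* approximate [v] shows that [g] is orthogonal to A^2, that                   *)
(* [pi <g, conj z> = - V], and that [2 pi |g|^2 = V].  For a constant [c] of   *)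
(* norm 1, i.e. [c^2 int w = pi], the form [<[T^*, T] c, c>] is the squared    *)
(* distance of [c conj z] to A^2, hence at least                               *)
(* [<g, c conj z>^2 / |g|^2 = 2 V / int w], which is the quotient of the       *)
(* torsional rigidity [2 V] by [int w].                                        *)

Require Import Defs.
From mathcomp Require Import all_boot all_order all_algebra complex.
From mathcomp Require Import all_classical all_reals all_analysis.
From mathcomp Require Import measurable_realfun.
From mathcomp Require Import ring lra.
Import Order.TTheory GRing.Theory Num.Theory.
Import numFieldNormedType.Exports.
Set Implicit Arguments.
Unset Strict Implicit.
Unset Printing Implicit Defensive.
Local Open Scope classical_set_scope.
Local Open Scope complex_scope.
Local Open Scope ring_scope.

(** * Real differentiability in the complex plane *)

(** For [f] of norm 1 in A^2 the quadratic form of the self-commutator is |z f|^2 - |P (conj z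
    f)|^2. As z f and conj z f have the same norm, this is the squared distance of conj z f to A^2,
    and any [g] orthogonal to A^2 bounds it from below through the component of conj z f along [g]
    ([self_commutator_lower_bound]). With [f] the normalised constant it remains to find a good [g],
    and the flux [wflux w v] of the Dirichlet solution is one: [flux_orthogonal], [ip_flux_conj] and
    [sq_flux] give its orthogonality to A^2, its pairing with conj z and its norm in terms of the
    integral of [v]; [rigidity_bound] combines them.

    The three identities come from one formula, [test_green]: for a test function [f], the real part
    of conj (del f) u + conj f delbar u has integral zero. It is used with [u] holomorphic, with u =
    conj z and with [u] the flux; then [f] approaches [v] in energy and in L^1 ([flux_approx]), as
    the boundary condition provides. A holomorphic [u] is known to be differentiable with delbar u =
    0, with no continuity of its derivative at hand, so the formula is proved by Goursat's bisection
    ([square_bisection], [green_rect]).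

    In these pairings the factor 1/w of the flux must cancel the weight of the measure. The equation
    itself ensures it: delbar of the flux is -1/2, so the zero set of the flux, which contains that
    of [w], is null ([null_zero_set], [weight_ae_neq0]).

    Projections and adjoints are selected by [xget], so their existence has to be established:
    [A2_projection] obtains it from the completeness of weighted L^2 ([riesz_fischer],
    [L2_complete]), working with the real inner product [ip], the real part of [winner]. *)

Section complex_plane.
Variable R : realType.
Implicit Types (z u a b : R[i]^o) (x y e r : R).

Lemma cmodE z : cmod z = Num.sqrt (complex.Re z ^+ 2 + complex.Im z ^+ 2).
Proof. by case: z. Qed.

Lemma cmod_sqr z : cmod z ^+ 2 = complex.Re z ^+ 2 + complex.Im z ^+ 2.
Proof. by rewrite cmodE sqr_sqrtr// addr_ge0// sqr_ge0. Qed.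

Lemma cmod_ge0 z : 0 <= cmod z.
Proof. by rewrite cmodE sqrtr_ge0. Qed.

Lemma cmod0 : cmod (0 : R[i]^o) = 0.
Proof. exact: ComplexField.Normc.normc0. Qed.

Lemma cmod_eq0 z : cmod z = 0 -> z = 0.
Proof. exact: ComplexField.Normc.eq0_normc. Qed.

Lemma cmodM z u : cmod (z * u) = cmod z * cmod u.
Proof. exact: ComplexField.Normc.normcM. Qed.

Lemma cmodD z u : cmod (z + u) <= cmod z + cmod u.
Proof. exact: le_normcD. Qed.

Lemma cmodN z : cmod (- z) = cmod z.
Proof. exact: normcN. Qed.

Lemma cmodB z u : cmod (z - u) = cmod (u - z).
Proof. by rewrite -cmodN opprB. Qed.

Lemma cmodJ z : cmod (z^*%C) = cmod z.
Proof. by rewrite !cmodE; case: z => x y /=; rewrite sqrrN. Qed.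

Lemma cmodR x : cmod (x%:C : R[i]^o) = `|x|.
Proof. by rewrite cmodE /= expr0n/= addr0 sqrtr_sqr. Qed.

Lemma cmod_Re z : `|complex.Re z| <= cmod z.
Proof. by rewrite cmodE -sqrtr_sqr ler_wsqrtr// lerDl sqr_ge0. Qed.

Lemma cmod_Im z : `|complex.Im z| <= cmod z.
Proof. by rewrite cmodE -sqrtr_sqr ler_wsqrtr// lerDr sqr_ge0. Qed.

Lemma cmod_le z : cmod z <= `|complex.Re z| + `|complex.Im z|.
Proof.
rewrite -(ler_pXn2r (_ : 0 < 2)%N) ?nnegrE ?cmod_ge0 ?addr_ge0//.
rewrite cmod_sqr sqrrD !real_normK ?num_real// -addrA [X in _ <= _ + X]addrC addrA.
by rewrite lerDl mulrn_wge0// mulr_ge0.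
Qed.

Lemma cnormE z : `|z| = (cmod z)%:C.
Proof. by []. Qed.

Lemma nbhs_cE z (A : set R[i]^o) :
  nbhs z A <-> exists2 e : R, 0 < e & forall u, cmod (u - z) < e -> A u.
Proof.
split=> [/nbhs_ballP[[e e']/= /[!ltcE]/= /andP[/eqP He e0]] h|[e e0 h]].
  exists e => // u hu; apply: h; rewrite -ball_normE/= cnormE cmodB ltcE/=.
  by rewrite hu -He eqxx.
apply/nbhs_ballP; exists e%:C; first by rewrite /= ltcR.
by move=> u; rewrite -ball_normE/= cnormE ltcR cmodB => /h.
Qed.

Lemma open_cP (U : set R[i]^o) : open U <->
  forall z, U z -> exists2 e : R, 0 < e & forall u, cmod (u - z) < e -> U u.
Proof. by rewrite openE; split=> h z /h /nbhs_cE. Qed.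

Lemma ccontP (f : R[i]^o -> R[i]^o) z : {for z, continuous f} <->
  forall e, 0 < e ->
  exists2 d, 0 < d & forall u, cmod (u - z) < d -> cmod (f u - f z) < e.
Proof.
split=> [h e e0|h].
  apply/nbhs_cE; apply: (h [set u | cmod (u - f z) < e]).
  by apply/nbhs_cE; exists e.
move=> A /nbhs_cE[e e0 hA]; apply/nbhs_cE; have [d d0 hd] := h _ e0.
by exists d => // u /hd/hA.
Qed.

(** Real differentiability, with the differential written h |-> a h + b conj h: [a] and [b] are the
    Wirtinger derivatives del f and delbar f, and b = 0 is complex differentiability. *)
Definition cdiff (f : R[i]^o -> R[i]^o) z a b := forall e, 0 < e ->
  exists2 d : R, 0 < d & forall u, cmod (u - z) < d ->
    cmod (f u - f z - (a * (u - z) + b * (u - z)^*%C)) <= e * cmod (u - z).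

Lemma cdiff_cont f z a b : cdiff f z a b -> {for z, continuous f}.
Proof.
move=> h; apply/ccontP => e e0; have [d d0 hd] := h 1 ltr01.
pose C := 1 + cmod a + cmod b.
have C0 : 0 < C by rewrite ltr_wpDr ?cmod_ge0// ltr_wpDr ?cmod_ge0.
exists (Num.min d (e / C)); first by rewrite lt_min d0 divr_gt0.
move=> u; rewrite lt_min => /andP[ud uC].
have -> : f u - f z = (f u - f z - (a * (u - z) + b * (u - z)^*%C))
   + (a * (u - z) + b * (u - z)^*%C) by rewrite subrK.
apply: le_lt_trans (cmodD _ _) _.
have := hd _ ud; have := cmodD (a * (u - z)) (b * (u - z)^*%C).
rewrite !cmodM cmodJ => h1 h2; rewrite ltr_pdivlMr// in uC.
apply: le_lt_trans uC; rewrite /C; lra.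
Qed.

Lemma cdiff_near f g z a b : (exists2 e : R, 0 < e & forall u, cmod (u - z) < e -> f u = g u) ->
  cdiff g z a b -> cdiff f z a b.
Proof.
move=> [e1 e10 fg] h e e0; have [d d0 hd] := h _ e0.
exists (Num.min d e1); first by rewrite lt_min d0.
move=> u; rewrite lt_min => /andP[ud ue].
rewrite !fg//; first exact: hd.
by rewrite subrr cmod0.
Qed.

Lemma cdiff0 z : cdiff (fun=> 0) z 0 0.
Proof.
move=> e e0; exists 1 => // u _.
by rewrite !(mul0r, addr0, subr0) cmod0 mulr_ge0 ?cmod_ge0// ltW.
Qed.

Lemma cdiffJ f z a b : cdiff f z a b -> cdiff (fun u => (f u)^*%C) z b^*%C a^*%C.
Proof.
move=> h e e0; have [d d0 hd] := h _ e0.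
exists d => // u ud; apply: le_trans (hd _ ud).
rewrite -[leRHS]cmodJ !(rmorphB, rmorphD, rmorphM)/=.
rewrite le_eqVlt; apply/orP; left; apply/eqP; congr cmod.
by rewrite !conjcK; ring.
Qed.

Lemma cdiffM f g z a b a' b' : cdiff f z a b -> cdiff g z a' b' ->
  cdiff (fun u => f u * g u) z (a * g z + f z * a') (b * g z + f z * b').
Proof.
move=> hf hg e e0.
pose C := 1 + cmod a + cmod b + cmod (f z) + cmod (g z).
have C0 : 1 <= C by rewrite /C -!addrA lerDl !addr_ge0 ?cmod_ge0.
have C1 : 0 < C by apply: lt_le_trans C0.
(* Each of the three error terms below is at most [C * e' * cmod (u - z)]. *)
pose e' := Num.min 1 (e / (3 * C)).
have e'0 : 0 < e' by rewrite lt_min ltr01 divr_gt0// mulr_gt0.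
have [d1 d10 h1] := hf _ e'0.
have [d2 d20 h2] := hg _ e'0.
have [d3 d30 h3] := (ccontP _ _).1 (cdiff_cont hg) _ e'0.
exists (Num.min d1 (Num.min d2 d3)); first by rewrite !lt_min d10 d20 d30.
move=> u; rewrite !lt_min => /and3P[{}/h1 h1 {}/h2 h2 {}/h3 h3].
set L1 := a * (u - z) + b * (u - z)^*%C in h1 *.
set L2 := a' * (u - z) + b' * (u - z)^*%C in h2 *.
set E1 := f u - f z - L1 in h1; set E2 := g u - g z - L2 in h2.
have -> : f u * g u - f z * g z -
   ((a * g z + f z * a') * (u - z) + (b * g z + f z * b') * (u - z)^*%C)
   = (E1 + L1) * (g u - g z) + E1 * g z + f z * E2.
  by rewrite /E1 /E2 /L1 /L2; ring.
have hL1 : cmod L1 <= (cmod a + cmod b) * cmod (u - z).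
  by apply: le_trans (cmodD _ _) _; rewrite !cmodM cmodJ mulrDl.
apply: le_trans (cmodD _ _) _; rewrite cmodM.
apply: le_trans (lerD (cmodD _ _) (lexx _)) _; rewrite !cmodM.
have h4 := cmodD E1 L1.
have e'1 : e' <= 1 by rewrite ge_min lexx.
have e'2 : e' * (3 * C) <= e by rewrite -ler_pdivlMr ?mulr_gt0// ge_min lexx orbT.
set r := cmod (u - z) in h1 h2 hL1 *.
have r0 : 0 <= r by exact: cmod_ge0.
have i1 : cmod (E1 + L1) * cmod (g u - g z) <= C * r * e'.
  apply: ler_pM; rewrite ?cmod_ge0// ?(ltW h3)//.
  apply: le_trans h4 _; apply: le_trans (lerD h1 hL1) _.
  rewrite -mulrDl ler_wpM2r// /C.
  have := cmod_ge0 (f z); have := cmod_ge0 (g z); lra.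
have i2 : cmod E1 * cmod (g z) <= e' * r * C.
  apply: ler_pM; rewrite ?cmod_ge0// /C.
  have := cmod_ge0 (f z); have := cmod_ge0 a; have := cmod_ge0 b; lra.
have i3 : cmod (f z) * cmod E2 <= C * (e' * r).
  apply: ler_pM; rewrite ?cmod_ge0// /C.
  have := cmod_ge0 (g z); have := cmod_ge0 a; have := cmod_ge0 b; lra.
have : e' * (3 * C) * r <= e * r by rewrite ler_wpM2r.
lra.
Qed.

Lemma derivable_cdiff f z : derivable f z 1 -> cdiff f z (derive1 f z) 0.
Proof.
rewrite derive1E /derivable => /cvg_ex[/= l hl].
have -> : 'D_1 f z = l by exact: (cvg_lim _ hl).
move=> e e0.
have hA : nbhs l [set y : R[i]^o | cmod (y - l) < e] by apply/nbhs_cE; exists e.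
have := hl _ hA; rewrite nbhs_simpl/= /dnbhs /within/= => /nbhs_cE[d d0 hd].
exists d => // u ud; rewrite mul0r addr0.
have [->|uz] := eqVneq u z; first by rewrite !subrr mulr0 subrr cmod0 mulr0.
have uz0 : u - z != 0 by rewrite subr_eq0.
have := hd (u - z); rewrite subr0 => /(_ ud uz0).
rewrite /GRing.scale/= mulr1 subrK => /ltW h.
have -> : f u - f z - l * (u - z) = ((u - z)^-1 * (f u - f z) - l) * (u - z).
  by rewrite mulrBl mulrAC mulVf// mul1r.
by rewrite cmodM ler_wpM2r ?cmod_ge0.
Qed.

Lemma mean_value (G G' : R -> R) x c e :
  (forall s, `|s| <= `|x| -> is_derive s (1 : R) G (G' s)) ->
  (forall s, `|s| <= `|x| -> `|G' s - c| <= e) ->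
  `|G x - G 0 - c * x| <= e * `|x|.
Proof.
move=> dG hG.
have key y1 y2 : y1 <= y2 -> `|y1| <= `|x| -> `|y2| <= `|x| ->
    `|G y2 - G y1 - c * (y2 - y1)| <= e * `|y2 - y1|.
  move=> y12 hy1 hy2.
  have hs s : s \in `[y1, y2] -> `|s| <= `|x|.
    rewrite in_itv/= => /andP[s1 s2].
    by rewrite ler_norml; move: hy1 hy2; rewrite !ler_norml; lra.
  have [||s sI ->] := @MVT_segment R G G' y1 y2 y12.
  - by move=> s sI; apply/dG/hs/subset_itv_oo_cc.
  - apply: derivable_within_continuous => s /hs sI.
    by have := dG _ sI; move=> /(@ex_derive _ _ _ _ _ _ _).
  by rewrite -mulrBl normrM ler_wpM2r// hG// hs.
have [x0|x0] := leP 0 x.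
  by have := key 0 x x0; rewrite subr0 normr0 normr_ge0; apply.
have := key x 0 (ltW x0); rewrite normr0 normr_ge0 sub0r !normrN lexx mulrN opprK => /(_ isT isT).
have -> : G x - G 0 - c * x = - (G 0 - G x + c * x) by ring.
by rewrite normrN.
Qed.

Lemma is_derive_shift (G : R -> R) s :
  derivable (fun t => G (s + t)) 0 1 -> is_derive s (1 : R) G (derive1 (fun t => G (s + t)) 0).
Proof.
move=> h.
have h' : is_derive (s - s) (1:R) (fun t => G (s + t)) (derive1 (fun t => G (s + t)) 0).
  by rewrite subrr derive1E; exact: DeriveDef.
have h2 : is_derive s (1:R) (fun x : R => x - s) 1.
  by apply: is_derive_eq; rewrite subr0.
have := @is_derive1_comp R (fun t => G (s + t)) (fun x => x - s) s _ _ h' h2.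
rewrite mulr1; congr is_derive; apply/funext => x /=; congr G; lra.
Qed.

(** The mean value theorem is applied to the real and the imaginary part separately, which costs the
    factor 2. *)
Lemma dir_mean_value (d : R[i]) f z x (c : R[i]^o) e :
  (forall s, `|s| <= `|x| -> dir_derivable d f (z + s%:C * d)) ->
  (forall s, `|s| <= `|x| -> cmod (dir_derive d f (z + s%:C * d) - c) <= e) ->
  cmod (f (z + x%:C * d) - f z - x%:C * c) <= 2 * e * `|x|.
Proof.
move=> hd hc.
have E s t : z + s%:C * d + t%:C * d = z + (s + t)%:C * d.
  by rewrite rmorphD/= mulrDl addrA.
have h1 : `|complex.Re (f (z + x%:C * d)) - complex.Re (f z) - complex.Re c * x| <= e * `|x|.
  have := @mean_value (fun s => complex.Re (f (z + s%:C * d)))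
    (fun s => complex.Re (dir_derive d f (z + s%:C * d))) x (complex.Re c) e.
  rewrite mul0r addr0; apply.
  - move=> s /hd[+ _]; rewrite /dir_derive/=.
    have -> : (fun t => complex.Re (f (z + s%:C * d + t%:C * d))) =
        (fun t => complex.Re (f (z + (s + t)%:C * d))) by apply/funext => t; rewrite E.
    exact: (@is_derive_shift (fun s => complex.Re (f (z + s%:C * d)))).
  - move=> s /hc; apply: le_trans; apply: le_trans (cmod_Re _).
    by rewrite raddfB.
have h2 : `|complex.Im (f (z + x%:C * d)) - complex.Im (f z) - complex.Im c * x| <= e * `|x|.
  have := @mean_value (fun s => complex.Im (f (z + s%:C * d)))
    (fun s => complex.Im (dir_derive d f (z + s%:C * d))) x (complex.Im c) e.
  rewrite mul0r addr0; apply.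
  - move=> s /hd[_]; rewrite /dir_derive/=.
    have -> : (fun t => complex.Im (f (z + s%:C * d + t%:C * d))) =
        (fun t => complex.Im (f (z + (s + t)%:C * d))) by apply/funext => t; rewrite E.
    exact: (@is_derive_shift (fun s => complex.Im (f (z + s%:C * d)))).
  - move=> s /hc; apply: le_trans; apply: le_trans (cmod_Im _).
    by rewrite raddfB.
apply: le_trans (cmod_le _) _.
move: h1 h2; case: (f _) => p q; case: (f z) => p' q'; case: c {hc} => c1 c2 /=.
rewrite !mul0r subr0 addr0 ![x * _]mulrC; lra.
Qed.

(** The increment from [z] to [u] is split into a vertical and then a horizontal leg; on each of
    them the partial derivative stays close to its value at [z] by continuity, and [dir_mean_value]
    applies. *)
Lemma class_C1_cdiff (U : set R[i]^o) f z : open U -> class_C 1 U f -> U z ->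
  cdiff f z (del f z) (delbar f z).
Proof.
move=> /open_cP oU [hd cx cy] Uz e e0.
have [r r0 hr] := oU _ Uz.
have e4 : 0 < e / 4 by rewrite divr_gt0.
have [d1 d10 h1] := (ccontP _ _).1 (cx _ Uz) _ e4.
have [d2 d20 h2] := (ccontP _ _).1 (cy _ Uz) _ e4.
pose m := Num.min r (Num.min d1 d2).
have m0 : 0 < m by rewrite !lt_min r0 d10 d20.
(* Both legs stay within [|x| + |y| <= 2 * cmod (u - z) < m] of [z]. *)
exists (m / 2); first by rewrite divr_gt0.
move=> u um.
pose x := complex.Re (u - z); pose y := complex.Im (u - z).
pose j : R[i]^o := 0 +i* 1.
have Eu : u = z + y%:C * j + x%:C * 1.
  rewrite /x /y /j; case: u {um} @x @y => u1 u2; case: z {oU Uz hr h1 h2} => z1 z2 /=.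
  by apply/eqP; rewrite eq_complex/=; apply/andP; split; apply/eqP; ring.
have xm : `|x| <= cmod (u - z) by exact: cmod_Re.
have ym : `|y| <= cmod (u - z) by exact: cmod_Im.
have bnd s t : `|s| <= `|x| -> `|t| <= `|y| -> cmod ((z + t%:C * j + s%:C * 1) - z) < m.
  move=> sx ty.
  have -> : z + t%:C * j + s%:C * 1 - z = t%:C * j + s%:C by rewrite mulr1; ring.
  apply: le_lt_trans (cmodD _ _) _; rewrite cmodM !cmodR.
  have -> : cmod j = 1 by rewrite cmodE/= expr0n/= add0r expr1n sqrtr1.
  lra.
have hx : cmod (f u - f (z + y%:C * j) - x%:C * dx f z) <= 2 * (e / 4) * `|x|.
  rewrite {1}Eu; apply: (@dir_mean_value 1 f (z + y%:C * j)) => s sx.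
    have := bnd _ _ sx (lexx `|y|); rewrite !lt_min => /and3P[+ _ _].
    by move=> /hr /hd[].
  have := bnd _ _ sx (lexx `|y|); rewrite !lt_min => /and3P[_ + _].
  by move=> /h1/ltW.
have hy : cmod (f (z + y%:C * j) - f z - y%:C * dy f z) <= 2 * (e / 4) * `|y|.
  have bnd' t : `|t| <= `|y| -> cmod ((z + t%:C * j) - z) < m.
    by move=> ty; have := bnd 0 t; rewrite mul0r addr0 normr0; apply.
  apply: dir_mean_value => s sy.
    have := bnd' _ sy; rewrite !lt_min => /and3P[+ _ _].
    by move=> /hr /hd[].
  have := bnd' _ sy; rewrite !lt_min => /and3P[_ _].
  by move=> /h2/ltW.
have -> : f u - f z - (del f z * (u - z) + delbar f z * (u - z)^*%C) =
   (f u - f (z + y%:C * j) - x%:C * dx f z) + (f (z + y%:C * j) - f z - y%:C * dy f z).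
  have -> : del f z * (u - z) + delbar f z * (u - z)^*%C = x%:C * dx f z + y%:C * dy f z.
    have Euz : u - z = x%:C + j * y%:C by rewrite {1}Eu; ring.
    have -> : (u - z)^*%C = x%:C - j * y%:C.
      by rewrite Euz; apply/eqP; rewrite eq_complex/=; apply/andP; split; apply/eqP; ring.
    rewrite Euz /del /delbar -/j.
    have jj : j * j = -1 by rewrite /j; apply/eqP; rewrite eq_complex/=; apply/andP; split; apply/eqP; ring.
    have -> : (dx f z - j * dy f z) / 2 * (x%:C + j * y%:C) + (dx f z + j * dy f z) / 2 * (x%:C - j * y%:C)
      = x%:C * dx f z - (j * j) * y%:C * dy f z by field.
    by rewrite jj; ring.
  by ring.
apply: le_trans (cmodD _ _) _; apply: le_trans (lerD hx hy) _.
have := ler_wpM2l (ltW e0) xm; have := ler_wpM2l (ltW e0) ym; lra.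
Qed.
End complex_plane.

(** * Topology and measurability in the plane *)

Section complex_plane2.
Variable R : realType.
Implicit Types (z u a b : R[i]^o) (x y e r : R) (f : R[i]^o -> R[i]^o).

Definition rcont_at (g : R[i]^o -> R) z := forall e, 0 < e ->
  exists2 d : R, 0 < d & forall u, cmod (u - z) < d -> `|g u - g z| < e.

Lemma rcont_Re f z : {for z, continuous f} -> rcont_at (fun u => complex.Re (f u)) z.
Proof.
move=> /ccontP h e /h[d d0 hd]; exists d => // u /hd; apply: le_lt_trans.
by rewrite -raddfB; exact: cmod_Re.
Qed.

Lemma rcont_Im f z : {for z, continuous f} -> rcont_at (fun u => complex.Im (f u)) z.
Proof.
move=> /ccontP h e /h[d d0 hd]; exists d => // u /hd; apply: le_lt_trans.
by rewrite -raddfB; exact: cmod_Im.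
Qed.

Lemma ler_dist_cmod z u : `|cmod z - cmod u| <= cmod (z - u).
Proof.
rewrite ler_norml; have := cmodD (z - u) u; rewrite subrK.
have := cmodD (u - z) z; rewrite subrK cmodB; lra.
Qed.

(** [U] is the union of the countably many rational squares that it contains. This passes from the
    topology of R[i] to the product sigma-algebra on R * R. *)
Lemma open_measurable_xy (U : set R[i]^o) : open U ->
  measurable (@of_xy R @^-1` U : set (measurableTypeR R * measurableTypeR R)).
Proof.
move=> /open_cP oU.
pose B (q : rat * rat * rat) : set (R * R) :=
  `]ratr q.1.1 - ratr q.2, ratr q.1.1 + ratr q.2[%classic `*`
  `]ratr q.1.2 - ratr q.2, ratr q.1.2 + ratr q.2[%classic.
pose F q := if `[< B q `<=` @of_xy R @^-1` U >] then B q else set0.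
have -> : @of_xy R @^-1` U = \bigcup_q F q.
  apply/seteqP; split => [[x y] Ux|[x y] [q _]]; last first.
    by rewrite /F; case: ifP => // /asboolP h /h.
  have [e e0 he] := oU _ Ux.
  have e4 : 0 < e / 4 by rewrite divr_gt0.
  have [r /itvP r0e] := @rat_in_itvoo R 0 (e / 4) e4.
  have r0 : 0 < ratr r :> R by rewrite r0e.
  have re : ratr r < e / 4 by rewrite r0e.
  have [qx] : exists q, (ratr q : R) \in `]x - ratr r, x + ratr r[.
    by apply: rat_in_itvoo; lra.
  rewrite in_itv/= => /andP[qx1 qx2].
  have [qy] : exists q, (ratr q : R) \in `]y - ratr r, y + ratr r[.
    by apply: rat_in_itvoo; lra.
  rewrite in_itv/= => /andP[qy1 qy2].
  exists (qx, qy, r) => //; rewrite /F ifT.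
    by split; rewrite /= in_itv/=; lra.
  apply/asboolP => -[x' y'] [] /=; rewrite !in_itv/= => /andP[x1 x2] /andP[y1 y2].
  apply: he; apply: le_lt_trans (cmod_le _) _ => /=.
  have : `|x' - x| < e / 2 by rewrite ltr_norml; lra.
  have : `|y' - y| < e / 2 by rewrite ltr_norml; lra.
  lra.
apply: countable_bigcupT_measurable => // q.
by rewrite /F; case: ifP => // _; apply: measurableX; exact: measurable_itv.
Qed.

Lemma rcont_measurable (U : set R[i]^o) (g : R[i]^o -> R) : open U ->
  (forall z, U z -> rcont_at g z) ->
  measurable_fun (@of_xy R @^-1` U) (fun p : measurableTypeR R * measurableTypeR R => g (of_xy p)).
Proof.
move=> oU hg; move=> mU; apply: (measurability _ (measurable_realfun.RGenOInfty.measurableE R)) => //.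
move=> /= _ [_ [x ->] <-].
have -> : @of_xy R @^-1` U `&` (fun p => g (of_xy p)) @^-1` `]x, +oo[%classic =
   @of_xy R @^-1` (U `&` [set z | x < g z]).
  by apply/seteqP; split => p /=; rewrite in_itv/= andbT.
apply: open_measurable_xy; apply/open_cP => z [Uz /= xz].
have [d1 d10 h1] := (open_cP _).1 oU _ Uz.
have [|d2 d20 h2] := hg _ Uz (g z - x); first by lra.
exists (Num.min d1 d2); first by rewrite lt_min d10.
move=> u; rewrite lt_min => /andP[/h1 ? /h2]; rewrite ltr_norml => ?; split=> //=; lra.
Qed.

Lemma compact_cbounded (K : set R[i]^o) : compact K ->
  exists2 M : R, 0 < M & forall z, K z -> cmod z < M.
Proof.
move=> cK.
have cc : continuous (@cmod R : R[i]^o -> R).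
  move=> z A /nbhs_ballP[e /= e0 hA]; apply/(nbhs_cE z); exists e => // u uz.
  by apply: hA; rewrite /ball/= distrC; apply: le_lt_trans uz; exact: ler_dist_cmod.
have /compact_bounded[M [Mr hM]] : compact (@cmod R @` K).
  by apply: continuous_compact => //; exact: continuous_subspaceT.
exists (Num.max 1 (M + 2)); first by rewrite lt_max ltr01.
move=> z Kz; rewrite lt_max; apply/orP; right.
have := hM (M + 1) _ (cmod z) (ex_intro2 _ _ z Kz erefl).
rewrite /= ger0_norm ?cmod_ge0// => h; have : cmod z <= M + 1 by apply: h; lra.
lra.
Qed.

Lemma c_hausdorff : hausdorff_space R[i]^o.
Proof.
move=> z u h; apply/eqP; apply/negPn/negP => zu.
have e0 : 0 < cmod (u - z) / 2.
  rewrite divr_gt0// lt_neqAle cmod_ge0 andbT eq_sym; apply: contra zu => /eqP/cmod_eq0/eqP.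
  by rewrite subr_eq0 eq_sym.
have [] := h [set y | cmod (y - z) < cmod (u - z) / 2] [set y | cmod (y - u) < cmod (u - z) / 2].
- by apply/nbhs_cE; exists (cmod (u - z) / 2).
- by apply/nbhs_cE; exists (cmod (u - z) / 2).
move=> y [/= y1 y2]; have := cmodD (u - y) (y - z).
by rewrite addrA subrK (cmodB u y); lra.
Qed.

Lemma compact_open_setC (K : set R[i]^o) : compact K -> open (~` K).
Proof. by move=> cK; rewrite openC; apply: compact_closed => //; exact: c_hausdorff. Qed.
End complex_plane2.

(** * Bisection of squares, and integrals over half-open intervals *)

(** Goursat's argument. If |L| is at least c times the area of some square, then by additivity one
    of its four quarters inherits this bound with the same c. Iterating gives nested squares
    shrinking to a point, where the local estimate with c / 2 is contradicted. *)
Lemma square_bisection (R : realType) (L : R -> R -> R -> R) :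
  (forall x y s, 0 < s -> L x y (s + s) =
     L x y s + L (x + s) y s + (L x (y + s) s + L (x + s) (y + s) s)) ->
  (forall x0 y0 e, 0 < e -> exists2 d, 0 < d & forall x y s, 0 < s -> s < d ->
     x <= x0 <= x + s -> y <= y0 <= y + s -> `|L x y s| <= e * s ^+ 2) ->
  forall x y s, 0 < s -> L x y s = 0.
Proof.
move=> hadd hloc x y s s0; apply/eqP; apply/negPn/negP => L0.
pose c := `|L x y s| / s ^+ 2.
have c0 : 0 < c by rewrite divr_gt0 ?normr_gt0// exprn_gt0.
pose big (p : R * R * R) := c * p.2 ^+ 2 <= `|L p.1.1 p.1.2 p.2|.
pose step (p : R * R * R) : R * R * R :=
  let t := p.2 / 2 in
  if `[< big (p.1, t) >] then (p.1, t)
  else if `[< big (p.1.1 + t, p.1.2, t) >] then (p.1.1 + t, p.1.2, t)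
  else if `[< big (p.1.1, p.1.2 + t, t) >] then (p.1.1, p.1.2 + t, t)
  else (p.1.1 + t, p.1.2 + t, t).
have stepP p : 0 < p.2 -> big p -> [/\ big (step p), (step p).2 = p.2 / 2,
    p.1.1 <= (step p).1.1 <= p.1.1 + p.2 / 2 & p.1.2 <= (step p).1.2 <= p.1.2 + p.2 / 2].
  case: p => -[a b] t /= t0 hp; rewrite /step/=.
  have t20 : 0 < t / 2 by rewrite divr_gt0.
  case: asboolP => [h1|/negP h1]; first by split=> //=; apply/andP; split; lra.
  case: asboolP => [h2|/negP h2]; first by split=> //=; apply/andP; split; lra.
  case: asboolP => [h3|/negP h3]; first by split=> //=; apply/andP; split; lra.
  split => //=; try by apply/andP; split; lra.
  move: hp h1 h2 h3; rewrite /big/= -!ltNge => hp h1 h2 h3.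
  rewrite leNgt; apply/negP => h4.
  have := hadd a b _ t20; rewrite -splitr => E; rewrite {}E in hp.
  have n1 := ler_normD (L a b (t / 2) + L (a + t / 2) b (t / 2))
    (L a (b + t / 2) (t / 2) + L (a + t / 2) (b + t / 2) (t / 2)).
  have n2 := ler_normD (L a b (t / 2)) (L (a + t / 2) b (t / 2)).
  have n3 := ler_normD (L a (b + t / 2) (t / 2)) (L (a + t / 2) (b + t / 2) (t / 2)).
  have : c * t ^+ 2 = 4 * (c * (t / 2) ^+ 2) by field.
  lra.
pose p n := iter n step (x, y, s).
have pP n : [/\ big (p n), (p n).2 = s / 2 ^+ n & 0 < (p n).2].
  elim: n => [|n [h1 h2 h3]].
    by split=> //=; rewrite ?expr0 ?divr1// /big/= /c divfK// expf_neq0// gt_eqF.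
  rewrite /p iterS -/(p n); have [h4 h5 _ _] := stepP _ h3 h1.
  by split=> //; rewrite h5 ?h2 ?divr_gt0 ?exprn_gt0// exprS invfM mulrA mulrAC.
have pm n m : [/\ (p n).1.1 <= (p (n + m)%N).1.1, (p (n + m)%N).1.1 + (p (n + m)%N).2 <= (p n).1.1 + (p n).2,
    (p n).1.2 <= (p (n + m)%N).1.2 & (p (n + m)%N).1.2 + (p (n + m)%N).2 <= (p n).1.2 + (p n).2].
  elim: m => [|m [h1 h2 h3 h4]]; first by rewrite addn0.
  rewrite addnS [p (n + m).+1]/p iterS -/(p (n + m)%N).
  have [b1 _ b2] := pP (n + m)%N; have [_ -> a1 a2] := stepP _ b2 b1.
  by split; lra.
(* For each coordinate, the supremum of the lower ends of the nested intervals belongs to all of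
   them. *)
have half_split (u : R * R * R -> R) : (forall n m, u (p n) <= u (p (n + m)%N) /\
    u (p (n + m)%N) + (p (n + m)%N).2 <= u (p n) + (p n).2) ->
    exists x0, forall n, u (p n) <= x0 <= u (p n) + (p n).2.
  move=> hu; pose S := [set u (p n) | n in [set: nat]].
  have ub n : ubound S (u (p n) + (p n).2).
    move=> _ [m _ <-].
    have [h1 _] := hu m n; have [_] := hu n m; rewrite addnC.
    have [_ _ h2] := pP (m + n)%N; lra.
  have S0 : S !=set0 by exists (u (p 0%N)); exists 0%N.
  exists (sup S) => n; apply/andP; split.
    apply: ub_le_sup; last by exists n.
    by exists (u (p 0%N) + (p 0%N).2); exact: ub.
  by apply: ge_sup => //; exact: ub.
have [x0 hx0] : exists x0, forall n, (p n).1.1 <= x0 <= (p n).1.1 + (p n).2.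
  by apply: (half_split (fun q => q.1.1)) => n m; have [] := pm n m.
have [y0 hy0] : exists y0, forall n, (p n).1.2 <= y0 <= (p n).1.2 + (p n).2.
  by apply: (half_split (fun q => q.1.2)) => n m; have [] := pm n m.
have c2 : 0 < c / 2 by rewrite divr_gt0.
have [d d0 hd] := hloc x0 y0 _ c2.
have [n hn] : exists n, s / 2 ^+ n < d.
  pose N := Num.bound (s / d); exists N.
  rewrite ltr_pdivrMr ?exprn_gt0// -ltr_pdivrMl// mulrC.
  apply: lt_trans (archi_boundP _) _; first by rewrite divr_ge0// ltW.
  by rewrite -natrX ltr_nat ltn_expl.
have [h1 h2 h3] := pP n.
have := hd _ _ _ h3 _ (hx0 n) (hy0 n); rewrite h2 => /(_ hn).
move: h1; rewrite /big h2 => h1 h4.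
have := le_trans h1 h4; rewrite ler_pM2r; first lra.
by rewrite exprn_gt0// -h2.
Qed.

Lemma le_bounded_integrable d (T : measurableType d) (R : realType)
    (mu : {measure set T -> \bar R}) (D : set T) (m M : R) (g : T -> R) :
  measurable D -> mu D = m%:E -> measurable_fun D g ->
  (forall t, D t -> `|g t| <= M) -> mu.-integrable D (EFin \o g).
Proof.
move=> mD muD mg hM; apply: measurable_bounded_integrable => //.
  by rewrite muD ltry.
exists M; split; first exact: num_real.
by move=> y My x Dx; apply: le_trans (hM _ Dx) (ltW My).
Qed.

Lemma Rintegral_near_cst d (T : measurableType d) (R : realType)
    (mu : {measure set T -> \bar R}) (D : set T) (m c M : R) (g : T -> R) :
  measurable D -> mu D = m%:E -> mu.-integrable D (EFin \o g) ->
  (forall t, D t -> `|g t - c| <= M) ->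
  `|\int[mu]_(t in D) g t - c * m| <= M * m.
Proof.
move=> mD muD ig hM.
have ic r : mu.-integrable D (EFin \o cst r).
  by apply: (le_bounded_integrable (M := `|r|) mD muD).
have -> : c * m = \int[mu]_(t in D) c by rewrite Rintegral_cst// muD.
rewrite -RintegralB//; last exact: (ic c).
have -> : M * m = \int[mu]_(t in D) M by rewrite Rintegral_cst// muD.
have ib : mu.-integrable D (EFin \o (fun t => g t - c)).
  by have := integrableB mD ig (ic c); apply: eq_integrable => //.
apply: le_trans (le_normr_Rintegral _ _) _ => //.
apply: le_Rintegral => //; last exact: (ic M).
exact: (integrable_norm ib).
Qed.

Lemma continuous_integrable_oc (R : realType) (g : R -> R) (a b : R) :
  continuous g -> lebesgue_measure.-integrable `]a, b] (EFin \o g).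
Proof.
move=> cg.
have : lebesgue_measure.-integrable `[a, b] (EFin \o g).
  by apply: continuous_compact_integrable; [exact: segment_compact|exact: continuous_subspaceT].
by apply: integrableS => //; exact: subset_itv_oc_cc.
Qed.

Lemma itv_oc_splitU (R : realType) (a s : R) : 0 < s ->
  `]a, a + (s + s)]%classic = `]a, a + s] `|` `]a + s, a + s + s] :> set R.
Proof.
move=> s0; apply/seteqP; split=> t /=; rewrite !in_itv/=; last by case; lra.
move=> /andP[t1 t2]; have [h|h] := leP t (a + s); [left|right]; lra.
Qed.

Lemma continuous_Rintegral_split (R : realType) (g : R -> R) (a s : R) :
  continuous g -> 0 < s ->
  \int[lebesgue_measure]_(t in `]a, a + (s + s)]) g t =
  \int[lebesgue_measure]_(t in `]a, a + s]) g t +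
  \int[lebesgue_measure]_(t in `]a + s, a + s + s]) g t.
Proof.
move=> cg s0; rewrite -Rintegral_setU//.
- by rewrite itv_oc_splitU.
- rewrite -(itv_oc_splitU _ s0); exact (continuous_integrable_oc a (a + (s + s)) cg).
- apply/disj_setPS => t [] /=; rewrite !in_itv/=; lra.
Qed.

(** * Green's formula for compactly supported functions *)

Section green.
Variable R : realType.
Implicit Types (x y s : R) (z : R[i]^o).
Local Notation leb := (@lebesgue_measure R).
Local Notation leb2 := (leb \x leb)%E.

Lemma continuous_sub (g h : R -> R) :
  continuous g -> continuous h -> continuous (fun t => g t - h t).
Proof. by move=> cg ch t; apply: (@continuousB _ R^o); [exact: cg|exact: ch]. Qed.

(** Half-open sides make the four quarters of a square an exact disjoint tiling. *)
Definition rect x y s : set (measurableTypeR R * measurableTypeR R) :=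
  `]x, x + s]%classic `*` `]y, y + s]%classic.

Lemma measurable_rect x y s : measurable (rect x y s).
Proof. by apply: measurableX; exact: measurable_itv. Qed.

Lemma lebesgue_oc (x s : R) : 0 < s -> leb `]x, x + s]%classic = s%:E.
Proof. by move=> s0; rewrite lebesgue_measure_itv/= lte_fin ltrDl s0 -EFinD addrAC subrr add0r. Qed.

Lemma leb2_rect x y s : 0 < s -> leb2 (rect x y s) = (s ^+ 2)%:E.
Proof. by move=> s0; rewrite product_measure1E//= !lebesgue_oc// -EFinM expr2. Qed.

Lemma rect_splitU x y s : 0 < s -> rect x y (s + s) =
  (rect x y s `|` rect (x + s) y s) `|` (rect x (y + s) s `|` rect (x + s) (y + s) s).
Proof.
move=> s0; rewrite /rect !itv_oc_splitU//.
by apply/seteqP; split=> -[a b] /=; tauto.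
Qed.

Lemma disjoint_rect x y x' y' s : x + s <= x' \/ y + s <= y' ->
  [disjoint rect x y s & rect x' y' s].
Proof.
move=> h; apply/disj_setPS => -[a b] [[/=]]; rewrite !in_itv/= => h1 h2 [/=].
by rewrite !in_itv/= => h3 h4; case: h; lra.
Qed.

Lemma Rintegral_rect_split (g : R * R -> R) x y s : 0 < s ->
  (forall x y s, 0 < s -> leb2.-integrable (rect x y s) (EFin \o g)) ->
  \int[leb2]_(p in rect x y (s + s)) g p =
  \int[leb2]_(p in rect x y s) g p + \int[leb2]_(p in rect (x + s) y s) g p +
  (\int[leb2]_(p in rect x (y + s) s) g p + \int[leb2]_(p in rect (x + s) (y + s) s) g p).
Proof.
move=> s0 ig; have s20 : 0 < s + s by lra.
have mr := measurable_rect; have h := ig x y _ s20; rewrite rect_splitU// in h.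
have mU x1 y1 x2 y2 : measurable (rect x1 y1 s `|` rect x2 y2 s) by exact: measurableU.
have mUU := measurableU _ _ (mU x y (x + s) y) (mU x (y + s) (x + s) (y + s)).
rewrite rect_splitU// (Rintegral_setU (mU _ _ _ _) (mU _ _ _ _) h).
- rewrite !Rintegral_setU//.
  + exact (integrableS mUU (mU _ _ _ _) (@subsetUr _ _ _) h).
  + by apply: disjoint_rect; left.
  + exact (integrableS mUU (mU _ _ _ _) (@subsetUl _ _ _) h).
  + by apply: disjoint_rect; left.
- apply/disj_setPS => -[a b] [] [] [/=]; rewrite !in_itv/= => h1 h2 [] [/=];
  rewrite !in_itv/=; lra.
Qed.

Lemma rcont_continuous_x (g : R[i]^o -> R) y : (forall z, rcont_at g z) ->
  continuous (fun x => g (x +i* y)).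
Proof.
move=> hg x A /nbhs_ballP[e /= e0 hA]; apply/nbhs_ballP.
have [d d0 hd] := hg (x +i* y) _ e0.
exists d => // x'; rewrite /ball/= => xx'; apply: hA; rewrite /ball/= distrC; apply: hd.
apply: le_lt_trans (cmod_le _) _.
by rewrite /= subrr normr0 addr0 distrC.
Qed.

Lemma rcont_continuous_y (g : R[i]^o -> R) x : (forall z, rcont_at g z) ->
  continuous (fun y => g (x +i* y)).
Proof.
move=> hg y A /nbhs_ballP[e /= e0 hA]; apply/nbhs_ballP.
have [d d0 hd] := hg (x +i* y) _ e0.
exists d => // y'; rewrite /ball/= => yy'; apply: hA; rewrite /ball/= distrC; apply: hd.
apply: le_lt_trans (cmod_le _) _.
by rewrite /= subrr normr0 add0r distrC.
Qed.

Lemma Re_affine_incr (c1 c2 a b : R[i]) s :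
  complex.Re c1 - complex.Re c2 - complex.Re (a + b) * s =
  complex.Re (c1 - c2 - (a * s%:C + b * (s%:C)^*%C)).
Proof. by case: c1 c2 a b => [? ?] [? ?] [? ?] [? ?] /=; ring. Qed.

Lemma Im_affine_incr (c1 c2 a b : R[i]) s :
  complex.Im c1 - complex.Im c2 - complex.Re (a - b) * s =
  complex.Im (c1 - c2 - (a * (0 +i* s) + b * (0 +i* s)^*%C)).
Proof. by case: c1 c2 a b => [? ?] [? ?] [? ?] [? ?] /=; ring. Qed.

(* Goursat's bisection argument: Green's formula holds for [u] under mere     *)
(* differentiability as soon as [delbar u] is continuous.                     *)
Lemma green_rect (u q : R[i]^o -> R[i]^o) (M : R) x y s :
  (forall z, exists a, cdiff u z a (q z)) ->
  (forall z, {for z, continuous q}) ->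
  (forall z, cmod (q z) <= M) -> 0 < s ->
  \int[leb]_(t in `]y, y + s]) complex.Re (u ((x + s) +i* t))
  - \int[leb]_(t in `]y, y + s]) complex.Re (u (x +i* t))
  - \int[leb]_(t in `]x, x + s]) complex.Im (u (t +i* (y + s)))
  + \int[leb]_(t in `]x, x + s]) complex.Im (u (t +i* y))
  - 2 * \int[leb2]_(p in rect x y s) complex.Re (q (of_xy p)) = 0.
Proof.
move=> du cq bq.
have cu z : {for z, continuous u} by have [a /cdiff_cont] := du z.
have cA x1 : continuous (fun t => complex.Re (u (x1 +i* t))).
  exact (@rcont_continuous_y (fun z => complex.Re (u z)) x1 (fun z => rcont_Re (cu z))).
have cB y1 : continuous (fun t => complex.Im (u (t +i* y1))).
  exact (@rcont_continuous_x (fun z => complex.Im (u z)) y1 (fun z => rcont_Im (cu z))).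
have mq : measurable_fun [set: measurableTypeR R * measurableTypeR R] (fun p => complex.Re (q (of_xy p))).
  apply: (@rcont_measurable R setT (fun z => complex.Re (q z))); first exact: openT.
  by move=> z _; exact (rcont_Re (cq z)).
have iq x1 y1 s1 : 0 < s1 -> leb2.-integrable (rect x1 y1 s1) (EFin \o (fun p => complex.Re (q (of_xy p)))).
  move=> s10; apply: (le_bounded_integrable (M := M) (measurable_rect x1 y1 s1) (leb2_rect x1 y1 s10)).
    exact (measurable_funTS mq).
  by move=> p _; apply: le_trans (cmod_Re _) _.
(* The four side integrals form the imaginary part of the contour integral of u dz around the
   square; Stokes' formula equates that contour integral with 2i times the area integral of delbar
   u. *)
pose L x y s :=
  \int[leb]_(t in `]y, y + s]) complex.Re (u ((x + s) +i* t))
  - \int[leb]_(t in `]y, y + s]) complex.Re (u (x +i* t))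
  - \int[leb]_(t in `]x, x + s]) complex.Im (u (t +i* (y + s)))
  + \int[leb]_(t in `]x, x + s]) complex.Im (u (t +i* y))
  - 2 * \int[leb2]_(p in rect x y s) complex.Re (q (of_xy p)).
apply: (@square_bisection R L) => {x y s}.
  move=> x y s s0; rewrite /L Rintegral_rect_split//.
  have sA x1 := continuous_Rintegral_split y (cA x1) s0.
  have sB y1 := continuous_Rintegral_split x (cB y1) s0.
  rewrite !sA !sB.
  rewrite !addrA; ring.
move=> x0 y0 e e0; have [a da] := du (x0 +i* y0).
pose b := q (x0 +i* y0).
have e20 : 0 < e / 20 by rewrite divr_gt0.
have [d1 d10 h1] := da _ e20.
have [d2 d20 h2] := (ccontP _ _).1 (cq (x0 +i* y0)) _ e20.
pose m := Num.min d1 d2; have m0 : 0 < m by rewrite lt_min d10.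
exists (m / 2) => [|x y s s0 sm hx hy]; first by rewrite divr_gt0.
have bnd x1 y1 : x <= x1 <= x + s -> y <= y1 <= y + s ->
    cmod (x1 +i* y1 - x0 +i* y0) <= 2 * s.
  move=> hx1 hy1; apply: le_trans (cmod_le _) _ => /=.
  have : `|x1 - x0| <= s by rewrite ler_norml; lra.
  have : `|y1 - y0| <= s by rewrite ler_norml; lra.
  lra.
have bd1 x1 y1 : x <= x1 <= x + s -> y <= y1 <= y + s -> cmod (x1 +i* y1 - x0 +i* y0) < d1.
  move=> hx1 hy1; apply: le_lt_trans (bnd _ _ hx1 hy1) _.
  have : m <= d1 by rewrite ge_min lexx.
  lra.
have bd2 x1 y1 : x <= x1 <= x + s -> y <= y1 <= y + s -> cmod (x1 +i* y1 - x0 +i* y0) < d2.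
  move=> hx1 hy1; apply: le_lt_trans (bnd _ _ hx1 hy1) _.
  have : m <= d2 by rewrite ge_min lexx orbT.
  lra.
(* [E] is the remainder of the first-order expansion at (x0, y0). The affine part contributes Re (a
   + b) s^2 on the vertical sides and Re (a - b) s^2 on the horizontal ones; their difference 2 Re b
   s^2 is cancelled by the area term. The errors add up to 1/5 + 1/5 + 2/20 = 1/2 of e s^2. *)
pose E z := u z - u (x0 +i* y0) - (a * (z - x0 +i* y0) + b * (z - x0 +i* y0)^*%C).
have dE p p' : E p - E p' = u p - u p' - (a * (p - p') + b * (p - p')^*%C).
  by rewrite /E !rmorphB/=; ring.
have hE x1 y1 : x <= x1 <= x + s -> y <= y1 <= y + s -> cmod (E (x1 +i* y1)) <= e / 10 * s.
  move=> hx1 hy1; apply: le_trans (h1 _ (bd1 _ _ hx1 hy1)) _.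
  have := ler_wpM2l (ltW e20) (bnd _ _ hx1 hy1); lra.
have i1 : `|(\int[leb]_(t in `]y, y + s]) complex.Re (u ((x + s) +i* t))
    - \int[leb]_(t in `]y, y + s]) complex.Re (u (x +i* t))) - complex.Re (a + b) * s * s| <= e / 5 * s * s.
  rewrite -(RintegralB _ (continuous_integrable_oc _ _ (cA _)) (continuous_integrable_oc _ _ (cA _))); last exact: measurable_itv.
  apply: Rintegral_near_cst.
  - exact: measurable_itv.
  - exact: lebesgue_oc.
  - exact (continuous_integrable_oc _ _ (continuous_sub (cA _) (cA _))).
  move=> t; rewrite /= in_itv/= => /andP[t1 t2].
  have -> : complex.Re (u ((x + s) +i* t)) - complex.Re (u (x +i* t)) - complex.Re (a + b) * s =
     complex.Re (E ((x + s) +i* t)) - complex.Re (E (x +i* t)).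
    rewrite Re_affine_incr -raddfB dE; congr (complex.Re (_ - (a * _ + b * _^*%C)));
    by apply/eqP; rewrite eq_complex/=; apply/andP; split; apply/eqP; ring.
  apply: le_trans (ler_normB _ _) _.
  have k1 : cmod (E ((x + s) +i* t)) <= e / 10 * s by apply: hE; lra.
  have k2 : cmod (E (x +i* t)) <= e / 10 * s by apply: hE; lra.
  have := cmod_Re (E ((x + s) +i* t)); have := cmod_Re (E (x +i* t)); lra.
have i2 : `|(\int[leb]_(t in `]x, x + s]) complex.Im (u (t +i* (y + s)))
    - \int[leb]_(t in `]x, x + s]) complex.Im (u (t +i* y))) - complex.Re (a - b) * s * s| <= e / 5 * s * s.
  rewrite -(RintegralB _ (continuous_integrable_oc _ _ (cB _)) (continuous_integrable_oc _ _ (cB _))); last exact: measurable_itv.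
  apply: Rintegral_near_cst.
  - exact: measurable_itv.
  - exact: lebesgue_oc.
  - exact (continuous_integrable_oc _ _ (continuous_sub (cB _) (cB _))).
  move=> t; rewrite /= in_itv/= => /andP[t1 t2].
  have -> : complex.Im (u (t +i* (y + s))) - complex.Im (u (t +i* y)) - complex.Re (a - b) * s =
     complex.Im (E (t +i* (y + s))) - complex.Im (E (t +i* y)).
    rewrite Im_affine_incr -raddfB dE; congr (complex.Im (_ - (a * _ + b * _^*%C)));
    by apply/eqP; rewrite eq_complex/=; apply/andP; split; apply/eqP; ring.
  apply: le_trans (ler_normB _ _) _.
  have k1 : cmod (E (t +i* (y + s))) <= e / 10 * s by apply: hE; lra.
  have k2 : cmod (E (t +i* y)) <= e / 10 * s by apply: hE; lra.
  have := cmod_Im (E (t +i* (y + s))); have := cmod_Im (E (t +i* y)); lra.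
have i3 : `|\int[leb2]_(p in rect x y s) complex.Re (q (of_xy p)) - complex.Re b * s ^+ 2| <= e / 20 * s ^+ 2.
  apply: Rintegral_near_cst => //.
  - exact: measurable_rect.
  - exact: leb2_rect.
  - exact: iq.
  move=> [x1 y1] [] /=; rewrite !in_itv/= => /andP[p1 p2] /andP[p3 p4].
  rewrite -raddfB; apply: le_trans (cmod_Re _) _; apply/ltW/h2.
  by apply: bd2; apply/andP; split => //; exact: ltW.
move: i1 i2 i3; rewrite /L !raddfB !raddfD /= !ler_norml expr2.
move: (\int[_]_(_ in _) _) (\int[_]_(_ in _) _) (\int[_]_(_ in _) _) (\int[_]_(_ in _) _) (\int[_]_(_ in _) _) => I1 I2 I3 I4 I5.
move: (complex.Re a) (complex.Re b) => ra rb.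
have : 0 < e * (s * s) by rewrite !mulr_gt0.
lra.
Qed.

(** On a square that contains the support in its interior the four side integrals vanish. The
    constant [M] is both a bound for [q] and a radius beyond which [u] and [q] are zero. *)
Lemma green_plane (u q : R[i]^o -> R[i]^o) (M : R) :
  (forall z, exists a, cdiff u z a (q z)) ->
  (forall z, {for z, continuous q}) ->
  (forall z, cmod (q z) <= M) ->
  (forall z, M <= cmod z -> u z = 0 /\ q z = 0) ->
  \int[leb2]_p complex.Re (q (of_xy p)) = 0.
Proof.
move=> du cq bq hz.
have M0 : 0 <= M by apply: le_trans (cmod_ge0 (q 0)) (bq 0).
pose N := M + 1.
have N0 : 0 < N by rewrite /N; lra.
have NN : 0 < N + N by lra.
have := @green_rect u q M (- N) (- N) (N + N) du cq bq NN.
have E : - N + (N + N) = N by ring.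
rewrite E.
have z1 t : u (N +i* t) = 0.
  have [] := hz (N +i* t) => //; apply: le_trans (cmod_Re _); rewrite /= ger0_norm; rewrite /N; lra.
have z2 t : u (- N +i* t) = 0.
  have [] := hz (- N +i* t) => //; apply: le_trans (cmod_Re _); rewrite /= normrN ger0_norm; rewrite /N; lra.
have z3 t : u (t +i* N) = 0.
  have [] := hz (t +i* N) => //; apply: le_trans (cmod_Im _); rewrite /= ger0_norm; rewrite /N; lra.
have z4 t : u (t +i* - N) = 0.
  have [] := hz (t +i* - N) => //; apply: le_trans (cmod_Im _); rewrite /= normrN ger0_norm; rewrite /N; lra.
under eq_Rintegral do rewrite z1.
under [in X in _ - X - _ + _]eq_Rintegral do rewrite z2.
under [in X in _ - _ - X + _]eq_Rintegral do rewrite z3.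
under [in X in _ - _ - _ + X - _]eq_Rintegral do rewrite z4.
rewrite /= !Rintegral_cst// !mul0r !subr0 addr0 sub0r => /eqP.
rewrite oppr_eq0 mulf_eq0 pnatr_eq0/= => /eqP; rewrite Rintegral_mkcond => <-.
apply: eq_Rintegral => -[x y] _; rewrite patchE; case: ifPn => //.
rewrite notin_setE /rect/= !in_itv/= E => h.
have [|_ ->//] := hz (x +i* y).
rewrite leNgt; apply/negP => hlt; apply: h.
have := le_lt_trans (cmod_Re _) hlt; have := le_lt_trans (cmod_Im _) hlt.
by rewrite /= !ltr_norml /N; split; lra.
Qed.

End green.

(** * Completeness of weighted L^2 *)

Lemma cvgn_dist_geometric (R : realType) (a : nat -> R) (K : R) :
  (forall n, `|a n.+1 - a n| <= K / 2 ^+ n) -> cvgn a.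
Proof.
move=> h.
have K0 : 0 <= K by have := le_trans (normr_ge0 _) (h 0%N); rewrite expr0 divr1.
have c1 : cvgn (series (fun n => a n.+1 - a n)).
  apply: (@normed_cvg R R^o); apply: (@series_le_cvg _ _ (geometric K (2^-1))) => //.
  - by move=> n /=; exact: normr_ge0.
  - by move=> n /=; rewrite mulr_ge0// exprn_ge0.
  - by move=> n; apply: le_trans (h n) _; rewrite /= exprVn.
  - by apply: is_cvg_geometric_series; rewrite ger0_norm; lra.
have -> : a = (fun n => a 0%N + series (fun n => a n.+1 - a n) n).
  apply/funext => n; rewrite /series/=; elim: n => [|n IHn].
    by rewrite big_geq// addr0.
  by rewrite big_nat_recr//= addrA -IHn addrC subrK.
by apply: (@is_cvgD _ R^o) => //; exact: is_cvg_cst.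
Qed.

Lemma measurable_sqrM d (T : measurableType d) (R : realType) (D : set T) (f w : T -> R) :
  measurable_fun D f -> measurable_fun D w ->
  measurable_fun D (fun x => (f x ^+ 2 * w x)%:E).
Proof.
move=> mf mw; apply/measurable_EFinP; apply: measurable_funM => //.
exact: measurable_funX.
Qed.

(** The rate 8^-n beats the factor 4^n in [S], so [S] is integrable and hence finite almost
    everywhere. Where it is finite and w > 0, the increments of the sequence are O(2^-n) and the
    sequence converges. Fatou's lemma then carries the L^2 bounds to the limit. *)
Lemma riesz_fischer d (T : measurableType d) (R : realType)
    (mu : {measure set T -> \bar R}) (D : set T) (w : T -> R) (a : nat -> T -> R) (C : R) :
  measurable D -> measurable_fun D w -> (forall x, D x -> 0 <= w x) ->
  (forall n, measurable_fun D (a n)) ->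
  (forall n m, (n <= m)%N ->
    (\int[mu]_(x in D) ((a m x - a n x) ^+ 2 * w x)%:E <= (C / 8 ^+ n)%:E)%E) ->
  exists2 f : T -> R, measurable_fun D f & forall n,
    (\int[mu]_(x in D) ((f x - a n x) ^+ 2 * w x)%:E <= (C / 8 ^+ n)%:E)%E.
Proof.
move=> mD mw w0 ma hC.
have mB m n : measurable_fun D (fun x => a m x - a n x) by exact: measurable_funB.
pose S x := (\sum_(0 <= n <oo) (4 ^+ n * ((a n.+1 x - a n x) ^+ 2 * w x))%:E)%E.
have t0 n x : D x -> (0 <= (4 ^+ n * ((a n.+1 x - a n x) ^+ 2 * w x))%:E)%E.
  by move=> Dx; rewrite lee_fin mulr_ge0 ?exprn_ge0// mulr_ge0 ?sqr_ge0// w0.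
have mt n : measurable_fun D (fun x => (4 ^+ n * ((a n.+1 x - a n x) ^+ 2 * w x))%:E).
  apply/measurable_EFinP; apply: measurable_funM => //.
  by apply/measurable_EFinP; exact: measurable_sqrM.
have S0 x : D x -> (0 <= S x)%E by move=> Dx; apply: nneseries_ge0 => n _ _; exact: t0.
have mS : measurable_fun D S.
  apply: (@ge0_emeasurable_sum _ _ _ _ (fun n x => (4 ^+ n * ((a n.+1 x - a n x) ^+ 2 * w x))%:E) predT) => //.
  by move=> k x Dx _; exact: t0.
have iS : (\int[mu]_(x in D) S x <= (2 * C)%:E)%E.
  rewrite integral_nneseries//; apply: lime_le.
    by apply: is_cvg_nneseries => n _ _; apply: integral_ge0 => x; exact: t0.
  apply: nearW => N.
  apply: (@le_trans _ _ (\sum_(0 <= n < N) (C / 2 ^+ n)%:E)%E).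
    apply: lee_sum => n _.
    under eq_integral do rewrite EFinM.
    rewrite ge0_integralZl//; last 2 first.
    - exact: measurable_sqrM.
    - by move=> x Dx; rewrite lee_fin mulr_ge0 ?sqr_ge0// w0.
    apply: (@le_trans _ _ ((4 ^+ n)%:E * (C / 8 ^+ n)%:E)%E).
      by apply: lee_wpmul2l; [rewrite lee_fin exprn_ge0|exact: hC].
    rewrite -EFinM lee_fin mulrCA ler_wpM2l//.
      have := le_trans (integral_ge0 _ _) (hC 0%N 0%N isT).
      rewrite expr0 divr1 lee_fin; apply => x Dx.
      by rewrite lee_fin mulr_ge0 ?sqr_ge0// w0.
    by rewrite ler_pdivrMr ?exprn_gt0// mulrC -exprVn -exprMn; apply: lerXn2r; rewrite ?nnegrE; lra.
  rewrite sumEFin lee_fin.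
  have C0 : 0 <= C.
    have := le_trans (integral_ge0 _ _) (hC 0%N 0%N isT).
    rewrite expr0 divr1 lee_fin; apply => x Dx.
    by rewrite lee_fin mulr_ge0 ?sqr_ge0// w0.
  have -> : \sum_(0 <= i < N) C / 2 ^+ i = 2 * C - 2 * C / 2 ^+ N.
    elim: N => [|N IH]; first by rewrite big_geq// expr0 divr1 subrr.
    by rewrite big_nat_recr//= IH exprS; field; rewrite expf_neq0.
  by rewrite lerBlDr lerDl !mulr_ge0// invr_ge0 exprn_ge0.
have ifin : mu.-integrable D S.
  apply/integrableP; split => //.
  rewrite (eq_integral S); first by apply: le_lt_trans iS _; rewrite ltry.
  by move=> x /[1!inE] Dx; rewrite gee0_abs ?S0.
have aeS := integrable_ae mD ifin.
have cvg_ae x : D x -> S x \is a fin_num -> 0 < w x -> cvgn (fun n => a n x).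
  move=> Dx Sx wx; have SE : (fine (S x))%:E = S x by rewrite fineK.
  have s0 : 0 <= fine (S x) by rewrite fine_ge0// S0.
  apply: (@cvgn_dist_geometric _ _ (Num.sqrt (fine (S x) / w x))) => n.
  have : (4 ^+ n * ((a n.+1 x - a n x) ^+ 2 * w x)) <= fine (S x).
    rewrite -lee_fin SE.
    have := @nneseries_lim_ge R (fun n => (4 ^+ n * ((a n.+1 x - a n x) ^+ 2 * w x))%:E) predT 0%N n.+1.
    move=> /(_ (fun n _ _ => t0 n x Dx)); rewrite big_nat_recr//=; apply: le_trans.
    by rewrite leeDr// sume_ge0// => i _; exact: t0.
  move=> hn.
  rewrite -(ler_pXn2r (_ : 0 < 2)%N) ?nnegrE ?divr_ge0 ?sqrtr_ge0 ?exprn_ge0//.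
  rewrite real_normK ?num_real// expr_div_n sqr_sqrtr ?divr_ge0 ?(ltW wx)//.
  rewrite -exprM mulnC exprM (_ : 2 ^+ 2 = 4 :> R); last by ring.
  by rewrite ler_pdivlMr ?exprn_gt0// ler_pdivlMr//; apply: le_trans hn; rewrite le_eqVlt; apply/orP; left; apply/eqP; ring.
(* The upper limit is measurable whether or not the sequence converges, and equals the limit where
   it does. *)
pose f x := fine (limn_esup (fun n => (a n x)%:E)).
have mf : measurable_fun D f.
  apply: (@measurableT_comp _ _ _ _ _ _ fine) => //.
  by apply: measurable_fun_limn_esup => n; exact/measurable_EFinP.
have fE x : cvgn (fun n => a n x) -> (fun n => a n x) @ \oo --> f x.
  move=> c; have c' : (fun n => (a n x)%:E) @ \oo --> (limn (fun n => a n x))%:E.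
    by apply: cvg_EFin => //; exact: nearW.
  by rewrite /f (cvg_limn_einf_sup c').2.
exists f => // n.
pose h k x := ((a (n + k)%N x - a n x) ^+ 2 * w x)%:E.
have mh k : measurable_fun D (h k) by exact: measurable_sqrM.
have h0 k x : D x -> (0 <= h k x)%E.
  by move=> Dx; rewrite lee_fin mulr_ge0 ?sqr_ge0// w0.
apply: (@le_trans _ _ (\int[mu]_(x in D) limn_einf (h^~ x))%E).
  apply: ae_ge0_le_integral => //.
  - by move=> x Dx; rewrite lee_fin mulr_ge0 ?sqr_ge0// w0.
  - by apply: measurable_sqrM => //; exact: measurable_funB.
  - move=> x Dx; rewrite limn_einf_lim; apply: lime_ge; first exact: is_cvg_einfs.
    apply: nearW => k; apply: le_ereal_inf_tmp => _ [j _ <-]; exact: h0.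
  - have -> : (fun x => limn_einf (h^~ x)) = (fun x => - limn_esup (fun k => - h k x))%E.
      by apply/funext => x; have := limn_esupN (h^~ x); rewrite /comp => ->; rewrite oppeK.
    apply: measurableT_comp => //; apply: measurable_fun_limn_esup => k.
    exact: measurableT_comp.
  - apply: filterS aeS => x hx Dx.
    (* Where the weight vanishes the sequence may diverge, but both integrands are zero. *)
    have [wx|wx] := eqVneq (w x) 0.
      have -> : (h^~ x) = (fun=> 0%E) by apply/funext => k; rewrite /h wx mulr0.
      by rewrite wx mulr0 (cvg_limn_einf_sup (cvg_cst _)).1.
    have wx0 : 0 < w x by rewrite lt_neqAle eq_sym wx w0.
    have c := fE _ (cvg_ae _ Dx (hx Dx) wx0).
    suff c' : (h^~ x) @ \oo --> ((f x - a n x) ^+ 2 * w x)%:E by rewrite (cvg_limn_einf_sup c').1.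
    apply: cvg_EFin; first exact: nearW.
    have c2 : (fun k => a (n + k)%N x - a n x) @ \oo --> f x - a n x.
      apply: (@cvgB _ R^o); last exact: cvg_cst.
      rewrite (_ : (fun k => a (n + k)%N x) = (fun k => a (k + n)%N x)).
        by rewrite (cvg_shiftn n (fun k => a k x)).
      by apply/funext => k; rewrite addnC.
    have c3 : (fun k => (a (n + k)%N x - a n x) ^+ 2) @ \oo --> (f x - a n x) ^+ 2.
      by under eq_fun do rewrite expr2; rewrite expr2; exact: (cvgM c2 c2).
    exact: (cvgM c3 (cvg_cst (w x))).
apply: le_trans (fatou _ _ _ _) _ => //.
rewrite limn_einf_lim; apply: lime_le; first exact: is_cvg_einfs.
apply: nearW => k; apply: le_trans (hC n (n + k)%N (leq_addr _ _)).
by apply: ereal_inf_lbound; exists k => //=.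
Qed.

(** Evaluation at the vertex -b/c. When c = 0 the polynomial is affine and bounded below, so b = 0:
    otherwise the chosen [t] gives the value -1. *)
Lemma discriminant_le (R : realType) (a b c : R) : 0 <= c ->
  (forall t, 0 <= a + 2 * b * t + c * t ^+ 2) -> b ^+ 2 <= a * c.
Proof.
move=> c0 h; have a0 := h 0; rewrite mulr0 expr0n/= mulr0 !addr0 in a0.
have [cE|cn] := eqVneq c 0.
  have [->|bn] := eqVneq b 0; first by rewrite expr0n/= mulr_ge0.
  have := h (- (a + 1) / (2 * b)); rewrite cE mul0r addr0.
  have -> : 2 * b * (- (a + 1) / (2 * b)) = - (a + 1) by field.
  lra.
have := h (- b / c).
have -> : a + 2 * b * (- b / c) + c * (- b / c) ^+ 2 = a - b ^+ 2 / c by field.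
by rewrite subr_ge0 ler_pdivrMr// lt_neqAle eq_sym cn.
Qed.

(** * The weighted L^2 space with its real inner product *)

Section weighted_L2.
Variables (R : realType) (Om : set R[i]^o) (w : R[i]^o -> R).
Local Notation leb2 := ((@lebesgue_measure R) \x (@lebesgue_measure R))%E.
Local Notation D := (@of_xy R @^-1` Om).
Hypothesis oOm : open Om.
Hypothesis mw : measurable_fun D (fun p : measurableTypeR R * measurableTypeR R => w (of_xy p)).
Hypothesis w0 : forall z, Om z -> 0 <= w z.
Implicit Types f g h : R[i]^o -> R[i]^o.
Local Notation L2 := (L2w Om w).

Definition cmeas f :=
  measurable_fun D (fun p : measurableTypeR R * measurableTypeR R => complex.Re (f (of_xy p))) /\
  measurable_fun D (fun p : measurableTypeR R * measurableTypeR R => complex.Im (f (of_xy p))).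

(** Density of the real part of the Hermitian pairing [winner]. The imaginary part is recovered by
    pairing with ['i * g] ([winnerE]), so that the Hilbert space arguments can be carried out over
    the reals. *)
Definition ipd f g (z : R[i]^o) : R :=
  (complex.Re (f z) * complex.Re (g z) + complex.Im (f z) * complex.Im (g z)) * (w z / pi).

Definition ip f g : R := \int[leb2]_(p in D) ipd f g (of_xy p).

Lemma measurable_D : measurable (D : set (measurableTypeR R * measurableTypeR R)).
Proof. exact: open_measurable_xy. Qed.

Lemma wpi_ge0 z : Om z -> 0 <= w z / pi.
Proof. by move=> /w0 wz; rewrite divr_ge0// pi_ge0. Qed.

Lemma ipdE f z : ipd f f z = cmod (f z) ^+ 2 * (w z / pi).
Proof. by rewrite /ipd cmod_sqr !expr2. Qed.

Lemma ipd_ge0 f z : Om z -> 0 <= ipd f f z.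
Proof. by move=> oz; rewrite ipdE mulr_ge0 ?sqr_ge0 ?wpi_ge0. Qed.

Lemma measurable_ipd f g : cmeas f -> cmeas g ->
  measurable_fun D (fun p : measurableTypeR R * measurableTypeR R => ipd f g (of_xy p)).
Proof.
move=> [f1 f2] [g1 g2]; apply: measurable_funM.
  by apply: measurable_funD; exact: measurable_funM.
by apply: measurable_funM => //; exact: measurable_cst.
Qed.

Lemma L2P f : L2 f <-> cmeas f /\ leb2.-integrable D (fun p => (ipd f f (of_xy p))%:E).
Proof.
have E : wnorm2 Om w f = (\int[leb2]_(p in D) `|(ipd f f (of_xy p))%:E|)%E.
  apply: eq_integral => p /[1!inE] Dp; rewrite gee0_abs ?ipdE//.
  by rewrite lee_fin -ipdE ipd_ge0.
split=> [[f1 f2 fi]|[[f1 f2] /integrableP[_ fi]]].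
  split=> //; apply/integrableP; split; last by rewrite -E.
  by apply/measurable_EFinP; exact: measurable_ipd.
by split=> //; rewrite E.
Qed.

Lemma L2_cmeas f : L2 f -> cmeas f.
Proof. by move=> /L2P[]. Qed.

Lemma integrable_ipd f g : L2 f -> L2 g ->
  leb2.-integrable D (EFin \o (fun p => ipd f g (of_xy p))).
Proof.
move=> /L2P[mf fi] /L2P[mg gi].
apply: (le_integrable measurable_D _ _ (integrableD measurable_D fi gi)).
  by apply/measurable_EFinP; exact: measurable_ipd.
move=> p Dp; rewrite /= lee_fin [leRHS](ger0_norm (addr_ge0 _ _)) ?ipd_ge0//.
rewrite /ipd -mulrDl normrM (ger0_norm (wpi_ge0 Dp)) ler_wpM2r ?wpi_ge0//.
move: (f _) (g _) => [a b] [c d] /=; rewrite ler_norml; apply/andP; split.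
  have := sqr_ge0 (a + c); have := sqr_ge0 (b + d); have := sqr_ge0 a; have := sqr_ge0 b.
  have := sqr_ge0 c; have := sqr_ge0 d; lra.
have := sqr_ge0 (a - c); have := sqr_ge0 (b - d); have := sqr_ge0 a; have := sqr_ge0 b.
have := sqr_ge0 c; have := sqr_ge0 d; lra.
Qed.

Lemma wnorm2E f : L2 f -> wnorm2 Om w f = (ip f f)%:E.
Proof.
move=> Lf; rewrite /ip /Rintegral fineK.
  by apply: eq_integral => p _; rewrite ipdE.
exact: (integrable_fin_num measurable_D (integrable_ipd Lf Lf)).
Qed.

Lemma wnormE f : L2 f -> wnorm Om w f = Num.sqrt (ip f f).
Proof. by move=> Lf; rewrite /wnorm wnorm2E. Qed.

Lemma ip_ge0 f : 0 <= ip f f.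
Proof. by apply: Rintegral_ge0 => p; exact: ipd_ge0. Qed.

Lemma winnerE f g : winner Om w f g = ip f g +i* ip f (fun z => 'i%C * g z).
Proof.
rewrite /winner /area_cintegral; congr (fine _ +i* fine _); apply: eq_integral => p _ /=;
  congr EFin; rewrite /ipd; move: (f _) (g _) => [a b] [c d] /=; ring.
Qed.

Lemma ipC f g : ip f g = ip g f.
Proof. by apply: eq_Rintegral => p _; rewrite /ipd; ring. Qed.

Lemma ipDl f g h : L2 f -> L2 g -> L2 h -> ip (fun z => f z + g z) h = ip f h + ip g h.
Proof.
move=> Lf Lg Lh; rewrite -RintegralD//; [|exact: measurable_D|exact: integrable_ipd..].
apply: eq_Rintegral => p _; rewrite /ipd; move: (f _) (g _) (h _) => [? ?] [? ?] [? ?] /=; ring.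
Qed.

Lemma ipBl f g h : L2 f -> L2 g -> L2 h -> ip (fun z => f z - g z) h = ip f h - ip g h.
Proof.
move=> Lf Lg Lh; rewrite -RintegralB//; [|exact: measurable_D|exact: integrable_ipd..].
apply: eq_Rintegral => p _; rewrite /ipd; move: (f _) (g _) (h _) => [? ?] [? ?] [? ?] /=; ring.
Qed.

Lemma ipBr f g h : L2 f -> L2 g -> L2 h -> ip h (fun z => f z - g z) = ip h f - ip h g.
Proof. by move=> Lf Lg Lh; rewrite ipC ipBl// ipC (ipC g). Qed.

Lemma ipZl c f h : L2 f -> L2 h -> ip (fun z => c%:C * f z) h = c * ip f h.
Proof.
move=> Lf Lh; rewrite -RintegralZl//; [|exact: measurable_D|exact: integrable_ipd].
apply: eq_Rintegral => p _; rewrite /ipd; move: (f _) (h _) => [? ?] [? ?] /=; ring.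
Qed.

Lemma ip_mul m f g : ip (fun z => m z * f z) g = ip f (fun z => (m z)^*%C * g z).
Proof.
by apply: eq_Rintegral => p _; rewrite /ipd; move: (m _) (f _) (g _) => [? ?] [? ?] [? ?] /=; ring.
Qed.

Lemma eq_ip f g f' g' : (forall z, Om z -> f z = f' z) -> (forall z, Om z -> g z = g' z) ->
  ip f g = ip f' g'.
Proof. by move=> ff gg; apply: eq_Rintegral => p /[1!inE] Dp; rewrite /ipd ff// gg. Qed.

Lemma cmeasD f g : cmeas f -> cmeas g -> cmeas (fun z => f z + g z).
Proof.
by move=> [f1 f2] [g1 g2]; split; under eq_fun do rewrite raddfD/=; exact: measurable_funD.
Qed.

Lemma cmeasM f g : cmeas f -> cmeas g -> cmeas (fun z => f z * g z).
Proof.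
move=> [f1 f2] [g1 g2]; split.
  have -> : (fun p => complex.Re (f (of_xy p) * g (of_xy p))) = (fun p => complex.Re (f (of_xy p)) *
     complex.Re (g (of_xy p)) - complex.Im (f (of_xy p)) * complex.Im (g (of_xy p))).
    by apply/funext => p; move: (f _) (g _) => [? ?] [? ?].
  by apply: measurable_funB; exact: measurable_funM.
have -> : (fun p => complex.Im (f (of_xy p) * g (of_xy p))) = (fun p => complex.Re (f (of_xy p)) *
   complex.Im (g (of_xy p)) + complex.Im (f (of_xy p)) * complex.Re (g (of_xy p))).
  by apply/funext => p; move: (f _) (g _) => [? ?] [? ?].
by apply: measurable_funD; exact: measurable_funM.
Qed.

Lemma cmeas_cst c : cmeas (fun=> c).
Proof. by split; exact: measurable_cst. Qed.

Lemma cmeas_cont f : (forall z, Om z -> {for z, continuous f}) -> cmeas f.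
Proof.
move=> cf; split.
  exact: (rcont_measurable oOm (fun z oz => rcont_Re (cf z oz))).
exact: (rcont_measurable oOm (fun z oz => rcont_Im (cf z oz))).
Qed.

Lemma L2_le f g C : cmeas f -> L2 g -> (forall z, Om z -> cmod (f z) ^+ 2 <= C * cmod (g z) ^+ 2) -> L2 f.
Proof.
move=> mf /L2P[_ gi] hC; apply/L2P; split=> //.
apply: (le_integrable measurable_D _ _ (integrableZl measurable_D C gi)).
  by apply/measurable_EFinP; exact: measurable_ipd.
move=> p Dp; rewrite /= lee_fin ger0_norm ?ipd_ge0// !ipdE.
apply: (@le_trans _ _ (C * (cmod (g (of_xy p)) ^+ 2 * (w (of_xy p) / pi)))); last exact: ler_norm.
by rewrite (mulrA C) ler_wpM2r ?wpi_ge0// hC.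
Qed.

Lemma L2M m f C : cmeas m -> (forall z, Om z -> cmod (m z) <= C) -> L2 f -> L2 (fun z => m z * f z).
Proof.
move=> mm hC Lf; apply: (@L2_le _ f (C ^+ 2)) => //.
  by apply: cmeasM => //; exact: L2_cmeas.
move=> z oz; rewrite cmodM exprMn ler_wpM2r ?sqr_ge0//.
by rewrite lerXn2r ?nnegrE ?cmod_ge0 ?hC// (le_trans (cmod_ge0 (m z)) (hC z oz)).
Qed.

Lemma L2Z c f : L2 f -> L2 (fun z => c * f z).
Proof. by apply: (@L2M (fun=> c) f (cmod c)) => //; exact: cmeas_cst. Qed.

Lemma L2D f g : L2 f -> L2 g -> L2 (fun z => f z + g z).
Proof.
move=> /L2P[mf fi] /L2P[mg gi]; apply/L2P; split; first exact: cmeasD.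
apply: (le_integrable measurable_D _ _
  (integrableZl measurable_D 2 (integrableD measurable_D fi gi))).
  by apply/measurable_EFinP; apply: measurable_ipd; exact: cmeasD.
move=> p Dp; rewrite /= lee_fin ger0_norm ?ipd_ge0//.
apply: (@le_trans _ _ (2 * (ipd f f (of_xy p) + ipd g g (of_xy p)))); last exact: ler_norm.
rewrite /ipd -mulrDl (mulrA 2) ler_wpM2r ?wpi_ge0//.
move: (f _) (g _) => [a b] [c d] /=.
have := sqr_ge0 (a - c); have := sqr_ge0 (b - d); lra.
Qed.

Lemma L2B f g : L2 f -> L2 g -> L2 (fun z => f z - g z).
Proof.
move=> Lf /(@L2Z (-1)) Lg; have := L2D Lf Lg.
by under eq_fun do rewrite mulN1r.
Qed.

Lemma ip_sqr_scale f g t : L2 f -> L2 g ->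
  ip (fun z => f z + t%:C * g z) (fun z => f z + t%:C * g z) = ip f f + 2 * ip f g * t + ip g g * t ^+ 2.
Proof.
move=> Lf Lg; have Lt := L2Z t%:C Lg; have Ls := L2D Lf Lt.
rewrite ipDl// ipC ipDl// ipZl// (ipC _ (fun z => f z + _)) ipDl// !ipZl//.
by rewrite (ipC f (fun z => t%:C * g z)) ipZl// (ipC g f) (ipC g (fun z => _ * _)) ipZl//; ring.
Qed.

Lemma cauchy_schwarz f g : L2 f -> L2 g -> ip f g ^+ 2 <= ip f f * ip g g.
Proof.
move=> Lf Lg; apply: discriminant_le; first exact: ip_ge0.
by move=> t; rewrite -ip_sqr_scale// ip_ge0.
Qed.

(** Written with the midpoint of [g] and [h], in the form that makes a sequence minimising the
    distance to [f] a Cauchy sequence. *)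
Lemma parallelogram f g h : L2 f -> L2 g -> L2 h ->
  ip (fun z => g z - h z) (fun z => g z - h z) =
  2 * ip (fun z => f z - g z) (fun z => f z - g z) + 2 * ip (fun z => f z - h z) (fun z => f z - h z)
  - 4 * ip (fun z => f z - (2^-1)%:C * (g z + h z)) (fun z => f z - (2^-1)%:C * (g z + h z)).
Proof.
move=> Lf Lg Lh; have Lgh := L2D Lg Lh; have L3 := L2Z (2^-1)%:C Lgh.
have B u v : L2 u -> L2 v -> ip (fun z => u z - v z) (fun z => u z - v z) = ip u u - 2 * ip u v + ip v v.
  move=> Lu Lv; have Luv := L2B Lu Lv.
  by rewrite ipBl// ipBr// ipBr// (ipC v u); ring.
rewrite !B//.
have -> : ip f (fun z => (2^-1)%:C * (g z + h z)) = 2^-1 * (ip f g + ip f h).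
  by rewrite ipC ipZl// ipDl// ipC (ipC h).
rewrite ipZl// (ipC _ (fun z => _ * _)) ipZl// ipDl// (ipC g (fun z => _ + _)) (ipC h (fun z => _ + _)).
by rewrite !ipDl// (ipC h g); field.
Qed.

(** [riesz_fischer] is applied to the real and the imaginary parts; adding the two bounds gives the
    factor 2. *)
Lemma L2_complete (g : nat -> R[i]^o -> R[i]^o) (C : R) : (forall n, L2 (g n)) ->
  (forall n m, (n <= m)%N -> ip (fun z => g m z - g n z) (fun z => g m z - g n z) <= C / 8 ^+ n) ->
  exists2 f, L2 f & forall n, ip (fun z => f z - g n z) (fun z => f z - g n z) <= 2 * C / 8 ^+ n.
Proof.
move=> Lg hC.
have part (P : R[i] -> R) :
  (forall n, measurable_fun D (fun p : measurableTypeR R * measurableTypeR R => P (g n (of_xy p)))) ->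
  (forall u v, P (u - v) = P u - P v) -> (forall u, P u ^+ 2 <= cmod u ^+ 2) ->
  exists2 F : measurableTypeR R * measurableTypeR R -> R, measurable_fun D F & forall n,
    (\int[leb2]_(p in D) ((F p - P (g n (of_xy p))) ^+ 2 * (w (of_xy p) / pi))%:E <= (C / 8 ^+ n)%:E)%E.
  move=> mP PB Pc.
  apply: (@riesz_fischer _ _ R leb2 D (fun p => w (of_xy p) / pi) (fun n p => P (g n (of_xy p)))) => //.
  - exact: measurable_D.
  - by apply: measurable_funM => //; exact: measurable_cst.
  - by move=> p; exact: wpi_ge0.
  move=> n m nm; have Ld := L2B (Lg m) (Lg n).
  apply: (@le_trans _ _ (ip (fun z => g m z - g n z) (fun z => g m z - g n z))%:E); last by rewrite lee_fin hC.
  rewrite -wnorm2E//; apply: ge0_le_integral => //.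
  - exact: measurable_D.
  - by move=> p Dp; rewrite lee_fin mulr_ge0 ?sqr_ge0// wpi_ge0.
  - apply: measurable_sqrM; last by apply: measurable_funM => //; exact: measurable_cst.
    by apply: measurable_funB; exact: mP.
  - under eq_fun do rewrite -(ipdE (fun z => g m z - g n z)).
    by apply/measurable_EFinP; apply: measurable_ipd; exact: L2_cmeas.
  - by move=> p Dp; rewrite lee_fin -PB ler_wpM2r ?wpi_ge0.
have [||F mF hF] := part (fun u => complex.Re u) (fun n => (L2_cmeas (Lg n)).1).
- by move=> u v; rewrite raddfB.
- by move=> u; rewrite cmod_sqr lerDl sqr_ge0.
have [||G mG hG] := part (fun u => complex.Im u) (fun n => (L2_cmeas (Lg n)).2).
- by move=> u v; rewrite raddfB.
- by move=> u; rewrite cmod_sqr lerDr sqr_ge0.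
pose f (z : R[i]^o) : R[i]^o := F (complex.Re z, complex.Im z) +i* G (complex.Re z, complex.Im z).
have Ef p : f (of_xy p) = F p +i* G p by case: p.
have mf : cmeas f.
  by split; under eq_fun do rewrite Ef.
have bnd n : (wnorm2 Om w (fun z => f z - g n z)%R <= (2 * C / 8 ^+ n)%:E)%E.
  have [g1 g2] := L2_cmeas (Lg n).
  have -> : (2 * C / 8 ^+ n)%:E = ((C / 8 ^+ n)%:E + (C / 8 ^+ n)%:E)%E by rewrite -EFinD; congr EFin; ring.
  apply: le_trans (leeD (hF n) (hG n)); rewrite -ge0_integralD//.
  - rewrite le_eqVlt; apply/orP; left; apply/eqP; apply: eq_integral => p _; rewrite Ef -EFinD cmod_sqr.
    by congr EFin; rewrite -mulrDl; move: (g _ _) => [? ?].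
  - exact: measurable_D.
  - by move=> p Dp; rewrite lee_fin mulr_ge0 ?sqr_ge0// wpi_ge0.
  - apply: measurable_sqrM; first exact: measurable_funB.
    by apply: measurable_funM => //; exact: measurable_cst.
  - by move=> p Dp; rewrite lee_fin mulr_ge0 ?sqr_ge0// wpi_ge0.
  - apply: measurable_sqrM; first exact: measurable_funB.
    by apply: measurable_funM => //; exact: measurable_cst.
have Ld n : L2 (fun z => f z - g n z).
  have [g1 g2] := L2_cmeas (Lg n).
  split; [under eq_fun do rewrite raddfB Ef/=..|by apply: le_lt_trans (bnd n) _; rewrite ltry];
  exact: measurable_funB.
exists f; last by move=> n; rewrite -lee_fin -wnorm2E.
have := L2D (Ld 0%N) (Lg 0%N).
by under eq_fun do rewrite subrK.
Qed.

End weighted_L2.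

(** * Holomorphic functions through their Wirtinger differentials *)

Section hol.
Variables (R : realType) (Om : set R[i]^o).
Implicit Types f g : R[i]^o -> R[i]^o.

Lemma cdiff_derivable f z a : cdiff f z a 0 -> derivable f z 1.
Proof.
move=> h; apply/cvg_ex; exists a => A /nbhs_cE[e e0 hA].
rewrite nbhs_simpl/= /dnbhs /within/=; apply/nbhs_cE.
have e20 : 0 < e / 2 by rewrite divr_gt0.
have [d d0 hd] := h _ e20; exists d => // u; rewrite subr0 => ud un; apply: hA.
have := hd (u + z); rewrite addrK => /(_ ud); rewrite mul0r addr0 => hu.
rewrite /GRing.scale/= mulr1.
have -> : u^-1 * (f (u + z) - f z) - a = u^-1 * (f (u + z) - f z - a * u).
  by rewrite [RHS]mulrBr [u^-1 * (a * u)]mulrCA mulVf// mulr1.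
have un0 : 0 < cmod u.
  by rewrite lt_neqAle cmod_ge0 andbT eq_sym; apply: contra un => /eqP/cmod_eq0/eqP.
have hh : cmod (u^-1) * cmod u = 1.
  by rewrite -cmodM mulVf// cmodE/= expr0n/= addr0 expr1n sqrtr1.
rewrite cmodM; apply: (@le_lt_trans _ _ (cmod u^-1 * (e / 2 * cmod u))).
  by rewrite ler_wpM2l ?cmod_ge0.
rewrite mulrCA hh; lra.
Qed.

Lemma holomorphic_cdiff f z : holomorphic Om f -> Om z -> cdiff f z (derive1 f z) 0.
Proof. by move=> hf oz; apply: derivable_cdiff; apply: hf. Qed.

Lemma holomorphic_continuous f z : holomorphic Om f -> Om z -> {for z, continuous f}.
Proof. by move=> hf oz; apply: cdiff_cont (holomorphic_cdiff hf oz). Qed.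

Lemma cdiffD f g z a b a' b' : cdiff f z a b -> cdiff g z a' b' ->
  cdiff (fun u => f u + g u) z (a + a') (b + b').
Proof.
move=> hf hg e e0; have e20 : 0 < e / 2 by rewrite divr_gt0.
have [d1 d10 h1] := hf _ e20; have [d2 d20 h2] := hg _ e20.
exists (Num.min d1 d2); first by rewrite lt_min d10.
move=> u; rewrite lt_min => /andP[{}/h1 h1 {}/h2 h2].
have -> : f u + g u - (f z + g z) - ((a + a') * (u - z) + (b + b') * (u - z)^*%C) =
  (f u - f z - (a * (u - z) + b * (u - z)^*%C)) + (g u - g z - (a' * (u - z) + b' * (u - z)^*%C)).
  by ring.
apply: le_trans (cmodD _ _) _; lra.
Qed.

Lemma cdiff_cst (c z : R[i]^o) : cdiff (fun=> c) z 0 0.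
Proof.
move=> e e0; exists 1 => // u _.
by rewrite subrr !(mul0r, addr0, subr0) cmod0 mulr_ge0 ?cmod_ge0// ltW.
Qed.

Lemma cdiff_id (z : R[i]^o) : cdiff id z 1 0.
Proof.
move=> e e0; exists 1 => // u _.
by rewrite /= mul1r mul0r addr0 subrr cmod0 mulr_ge0 ?cmod_ge0// ltW.
Qed.

Lemma holomorphicM f g : holomorphic Om f -> holomorphic Om g -> holomorphic Om (fun z => f z * g z).
Proof.
move=> hf hg z oz; have := cdiffM (holomorphic_cdiff hf oz) (holomorphic_cdiff hg oz).
by rewrite mul0r mulr0 addr0 => /cdiff_derivable.
Qed.

Lemma holomorphicD f g : holomorphic Om f -> holomorphic Om g -> holomorphic Om (fun z => f z + g z).
Proof.
move=> hf hg z oz; have := cdiffD (holomorphic_cdiff hf oz) (holomorphic_cdiff hg oz).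
by rewrite addr0 => /cdiff_derivable.
Qed.

Lemma holomorphic_cst (c : R[i]^o) : holomorphic Om (fun=> c).
Proof. by move=> z _; exact: cdiff_derivable (cdiff_cst c z). Qed.

Lemma holomorphic_id : holomorphic Om id.
Proof. by move=> z _; exact: cdiff_derivable (cdiff_id z). Qed.

End hol.

Lemma bounded_cmod (R : realType) (Om : set R[i]^o) : bounded_set Om ->
  exists M : R, forall z, Om z -> cmod z <= M.
Proof.
move=> [M [Mr hM]]; exists (complex.Re M + 1) => z oz.
have : `|z| <= M + 1 by apply: hM => //; rewrite ltrDl.
by rewrite cnormE; case: (M) => a b; rewrite lecE/= => /andP[].
Qed.

Lemma geometric8_lt (R : realType) (C e : R) : 0 < e -> exists n, C / 8 ^+ n < e.
Proof.
move=> e0; pose N := Num.bound (`|C| / e); exists N.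
rewrite ltr_pdivrMr ?exprn_gt0// -ltr_pdivrMl// mulrC.
have h : `|C| / e < N%:R by apply: archi_boundP; rewrite divr_ge0// ltW.
apply: (@le_lt_trans _ _ (`|C| / e)); first by rewrite ler_wpM2r ?invr_ge0 ?(ltW e0)// ler_norm.
by apply: lt_trans h _; rewrite -natrX ltr_nat ltn_expl.
Qed.

(** * The Bergman space and the self-commutator *)

Section bergman.
Variables (R : realType) (Om : set R[i]^o) (w : R[i]^o -> R) (M : R).
Local Notation leb2 := ((@lebesgue_measure R) \x (@lebesgue_measure R))%E.
Local Notation D := (@of_xy R @^-1` Om).
Hypothesis oOm : open Om.
Hypothesis mw : measurable_fun D (fun p : measurableTypeR R * measurableTypeR R => w (of_xy p)).
Hypothesis w0 : forall z, Om z -> 0 <= w z.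
Hypothesis OmM : forall z, Om z -> cmod z <= M.
Implicit Types f g h : R[i]^o -> R[i]^o.
Local Notation L2 := (L2w Om w).
Local Notation A2 := (A2w Om w).
Local Notation ip := (ip Om w).
Local Notation sq f := (ip f f).
Local Notation T := (toeplitz Om w id).

Let L2D' := L2D oOm mw w0.
Let L2B' := L2B oOm mw w0.
Let L2Z' := L2Z oOm mw w0.
Let CS := cauchy_schwarz oOm mw w0.
Let sq_ge0 := ip_ge0 w0.

Lemma sqM_le m f C : cmeas Om m -> (forall z, Om z -> cmod (m z) <= C) -> L2 f ->
  sq (fun z => m z * f z) <= C ^+ 2 * sq f.
Proof.
move=> mm hC Lf; have Lmf := L2M oOm mw w0 mm hC Lf.
rewrite -RintegralZl//; [|exact: measurable_D|exact: integrable_ipd].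
apply: le_Rintegral => //.
- exact: measurable_D.
- exact: integrable_ipd.
- by have := integrableZl (measurable_D oOm) (C ^+ 2) (integrable_ipd oOm mw w0 Lf Lf).
move=> p Dp; rewrite !ipdE cmodM exprMn -[leLHS]mulrA ler_wpM2r//.
  by apply: mulr_ge0; [exact: sqr_ge0|exact: (wpi_ge0 w0)].
by rewrite lerXn2r ?nnegrE ?cmod_ge0 ?hC// (le_trans (cmod_ge0 (m (of_xy p))) (hC _ Dp)).
Qed.

Lemma sqD_le f g : L2 f -> L2 g -> sq (fun z => f z + g z) <= 2 * sq f + 2 * sq g.
Proof.
move=> Lf Lg; have LB := L2B' Lf Lg.
have E1 := ip_sqr_scale oOm mw w0 1 Lf Lg; have E2 := ip_sqr_scale oOm mw w0 (- 1) Lf Lg.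
have -> : sq (fun z => f z + g z) = sq (fun z => f z + (1 : R)%:C * g z).
  by apply: eq_ip => z _; rewrite mul1r.
have := sq_ge0 (fun z => f z + (-1 : R)%:C * g z); rewrite E1 E2; lra.
Qed.

Lemma A2_L2 f : A2 f -> L2 f.
Proof. by case. Qed.

Lemma A2_approx f e : A2 f -> 0 < e ->
  exists h, [/\ holomorphic Om h, L2 h & sq (fun z => f z - h z) < e].
Proof.
move=> [Lf hf] e0; have [|h [hh Lh hlt]] := hf (Num.sqrt e); first by rewrite sqrtr_gt0.
exists h; split=> //; move: hlt; rewrite (wnormE oOm mw w0); last exact: L2B'.
by rewrite ltr_sqrt.
Qed.

Lemma A2_holomorphic h : holomorphic Om h -> L2 h -> A2 h.
Proof.
move=> hh Lh; split=> // e e0; exists h; split=> //.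
rewrite (wnormE oOm mw w0); last exact: L2B'.
have -> : ip (h \- h) (h \- h) = 0.
  rewrite (@eq_ip _ _ _ _ _ (fun=> (0 : R)%:C * 0) (fun=> 0))//; try by move=> z _ /=; rewrite subrr ?mulr0.
  by rewrite /ip/= /Rintegral; under eq_integral do rewrite /ipd /= !mulr0 addr0 mul0r; rewrite integral0.
by rewrite sqrtr0.
Qed.

Lemma A2_closed f : L2 f -> (forall e, 0 < e -> exists2 h, A2 h & sq (fun z => f z - h z) < e) -> A2 f.
Proof.
move=> Lf hf; split=> // e e0.
have e4 : 0 < e ^+ 2 / 4 by rewrite divr_gt0// exprn_gt0.
have [h Ah fh] := hf _ e4; have [k [hk Lk kh]] := A2_approx Ah e4.
exists k; split=> //; rewrite (wnormE oOm mw w0); last exact: L2B'.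
rewrite -[ltRHS](ger0_norm (ltW e0)) -sqrtr_sqr ltr_sqrt ?exprn_gt0//.
have -> : sq (f \- k) = sq (fun z => (f z - h z) + (h z - k z)).
  by apply: eq_ip => z _ /=; rewrite addrA subrK.
have Lh := A2_L2 Ah.
apply: le_lt_trans (sqD_le (L2B' Lf Lh) (L2B' Lh Lk)) _; lra.
Qed.

(** Multiplication by [m] sends holomorphic approximants of [f] to holomorphic approximants of the
    product, with squared error enlarged by at most C^2. *)
Lemma A2_mul m f C : holomorphic Om m -> (forall z, Om z -> cmod (m z) <= C) -> A2 f ->
  A2 (fun z => m z * f z).
Proof.
move=> hm hC Af.
have mm : cmeas Om m := (cmeas_cont oOm (fun z oz => holomorphic_continuous hm oz)).
have Lf := A2_L2 Af.
apply: A2_closed => [|e e0]; first exact: (L2M oOm mw w0 mm hC).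
have C1 : 0 < C ^+ 2 + 1 by rewrite ltr_wpDl ?sqr_ge0.
have [|h [hh Lh fh]] := @A2_approx f (e / (C ^+ 2 + 1)) Af; first by rewrite divr_gt0.
have Lmh := L2M oOm mw w0 mm hC Lh.
exists (fun z => m z * h z).
  exact (A2_holomorphic (holomorphicM hm hh) Lmh).
have -> : sq (fun z => m z * f z - m z * h z) = sq (fun z => m z * (f z - h z)).
  by apply: eq_ip => z _; rewrite mulrBr.
apply: le_lt_trans (sqM_le mm hC (L2B' Lf Lh)) _.
rewrite ltr_pdivlMr// in fh; apply: le_lt_trans fh.
by rewrite mulrDr mulr1 mulrC lerDl.
Qed.

Lemma A2Z c f : A2 f -> A2 (fun z => c * f z).
Proof.
exact (@A2_mul (fun=> c) f (cmod c) (@holomorphic_cst R Om c) (fun _ _ => lexx _)).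
Qed.

Lemma A2id f : A2 f -> A2 (fun z => z * f z).
Proof. exact (@A2_mul id f M (@holomorphic_id R Om) OmM). Qed.

Lemma A2D f g : A2 f -> A2 g -> A2 (fun z => f z + g z).
Proof.
move=> Af Ag; have Lf := A2_L2 Af; have Lg := A2_L2 Ag.
apply: A2_closed => [|e e0]; first exact: L2D'.
have e4 : 0 < e / 4 by rewrite divr_gt0.
have [h [hh Lh fh]] := A2_approx Af e4; have [k [hk Lk gk]] := A2_approx Ag e4.
exists (fun z => h z + k z).
  exact (A2_holomorphic (holomorphicD hh hk) (L2D' Lh Lk)).
have -> : sq (fun z => f z + g z - (h z + k z)) = sq (fun z => (f z - h z) + (g z - k z)).
  by apply: eq_ip => z _; rewrite opprD addrACA.
apply: le_lt_trans (sqD_le (L2B' Lf Lh) (L2B' Lg Lk)) _; lra.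
Qed.

Lemma A2B f g : A2 f -> A2 g -> A2 (fun z => f z - g z).
Proof. by move=> Af /(@A2Z (-1)) Ag; have := A2D Af Ag; under eq_fun do rewrite mulN1r. Qed.

Lemma L2_0 : L2 (fun=> 0).
Proof.
split; [exact: measurable_cst..|].
rewrite /wnorm2 /area_integral; under eq_integral do rewrite cmod0 expr0n/= mul0r.
by rewrite integral0 ltry.
Qed.

Lemma A2_0 : A2 (fun=> 0).
Proof. exact (A2_holomorphic (@holomorphic_cst R Om 0) L2_0). Qed.

(** The projection is the limit of a sequence in A^2 minimising the distance to [f], which is Cauchy
    by the parallelogram law. Near-minimality makes each term nearly orthogonal to [h], and this
    passes to the limit. *)
Lemma A2_projection f : L2 f -> exists2 g, A2 g & forall h, A2 h -> ip (fun z => f z - g z) h = 0.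
Proof.
move=> Lf; pose E := [set sq (fun z => f z - h z) | h in A2].
have E0 : E !=set0 by exists (sq (fun z => f z - 0)); exists (fun=> 0) => //; exact: A2_0.
have lE : lbound E 0 by move=> _ [h _ <-]; exact: sq_ge0.
have hE : has_inf E by split => //; exists 0.
pose d := inf E.
have dle h : A2 h -> d <= sq (fun z => f z - h z).
  by move=> Ah; apply: ge_inf; [exists 0|exists h].
have ex n : exists h, A2 h /\ sq (fun z => f z - h z) < d + 1 / 8 ^+ n.
  have [|_ [h Ah <-] hlt] := @inf_adherent _ E (1 / 8 ^+ n) _ hE.
    by rewrite divr_gt0// exprn_gt0.
  by exists h.
have [hs hsP] := choice ex.
have Ah n := (hsP n).1; have Lh n := A2_L2 (Ah n).
(* The constant 4 comes from 2 (d + 8^-m) + 2 (d + 8^-n) - 4 d, where m >= n and the midpoint is at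
   squared distance at least d. *)
have [n m nm|g Lg hg] := @L2_complete _ _ _ oOm mw w0 hs 4 Lh.
  have Lfh k := L2B' Lf (Lh k).
  rewrite (parallelogram oOm mw w0 Lf (Lh m) (Lh n)).
  have := dle _ (A2Z (2^-1)%:C (A2D (Ah m) (Ah n))).
  have := (hsP n).2; have := (hsP m).2.
  have : 1 / 8 ^+ m <= 1 / 8 ^+ n :> R.
    rewrite !div1r lef_pV2 ?posrE ?exprn_gt0//; apply: ler_weXn2l => //; lra.
  lra.
have Ag : A2 g.
  apply: A2_closed => // e e0; have [n hn] := geometric8_lt (2 * 4) e0.
  by exists (hs n) => //; exact: le_lt_trans (hg n) hn.
exists g => // h Ahh; have Lhh := A2_L2 Ahh.
(* Moving [hs n] along [h] cannot bring the squared distance below d, so a quadratic polynomial in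
   [t] with constant term 8^-n is nonnegative. *)
have hb n : ip (fun z => f z - hs n z) h ^+ 2 <= 1 / 8 ^+ n * sq h.
  apply: discriminant_le => [|t]; first exact: sq_ge0.
  have := dle _ (A2D (Ah n) (A2Z (- t%:C) Ahh)).
  have -> : sq (fun z => f z - (hs n z + - t%:C * h z)) = sq (fun z => (f z - hs n z) + t%:C * h z).
    by apply: eq_ip => z _; rewrite mulNr opprD opprK addrA.
  rewrite (ip_sqr_scale oOm mw w0 t (L2B' Lf (Lh n)) Lhh); have := (hsP n).2; lra.
apply/eqP; rewrite -sqrf_eq0 eq_le sqr_ge0 andbT leNgt; apply/negP => pos.
(* Here 18 = 2 * 1 + 2 * 8, from (x - y)^2 <= 2 x^2 + 2 y^2 with the bounds of [hb] and [hg]. *)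
have [n] := geometric8_lt (18 * sq h) pos; apply/negP; rewrite -leNgt.
have -> : ip (fun z => f z - g z) h = ip (fun z => f z - hs n z) h - ip (fun z => g z - hs n z) h.
  rewrite -(ipBl oOm mw w0 (L2B' Lf (Lh n)) (L2B' Lg (Lh n)) Lhh).
  by apply: eq_ip => z _ //; rewrite opprB addrA subrK.
have h1 := hb n; have h2 := CS (L2B' Lg (Lh n)) Lhh.
have h3 := ler_wpM2r (sq_ge0 h) (hg n).
move: (ip (fun z => f z - hs n z) h) (ip (fun z => g z - hs n z) h) h1 h2 h3 => x y h1 h2 h3.
have := sqr_ge0 (x + y); have := le_trans h2 h3.
have -> : 2 * 4 / 8 ^+ n * sq h = 8 * (sq h / 8 ^+ n) by ring.
have -> : 18 * sq h / 8 ^+ n = 18 * (sq h / 8 ^+ n) by ring.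
move: h1; have -> : 1 / 8 ^+ n * sq h = (sq h / 8 ^+ n) by ring.
lra.
Qed.

(** A^2 is stable under multiplication by i, so real orthogonality to it is complex
    orthogonality. *)
Lemma winner_eq0 f : L2 f -> (forall h, A2 h -> ip f h = 0) -> forall h, A2 h -> winner Om w f h = 0.
Proof. by move=> Lf hf h Ah; rewrite winnerE !hf//; exact: A2Z. Qed.

(** As z f already lies in A^2, the difference z f - T f is in A^2 and orthogonal to A^2, hence of
    norm zero. [T f] is determined up to null sets, so the conclusion is an equality of pairings. *)
Lemma toeplitzP f : A2 f -> A2 (T f) /\ forall k, L2 k -> ip (T f) k = ip (fun z => z * f z) k.
Proof.
move=> Af; have Azf := A2id Af; have Lzf := A2_L2 Azf.
have [Ag hg] : is_A2proj Om w (fun z => z * f z) (T f).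
  rewrite /toeplitz /A2proj; apply: (@xgetPex _ (fun=> 0) [set g | is_A2proj Om w (fun z => z * f z) g]).
  have [g Ag hg] := A2_projection Lzf.
  by exists g; split=> //; apply: winner_eq0 => //; exact: (L2B' Lzf (A2_L2 Ag)).
split=> // k Lk; have LTf := A2_L2 Ag.
have Ad := A2B Azf Ag; have Ld := A2_L2 Ad.
have d0 : sq (fun z => z * f z - T f z) = 0.
  by have := hg _ Ad; rewrite winnerE => -[].
have := CS Ld Lk; rewrite d0 mul0r ipBl// => h.
have /eqP : (ip (fun z => z * f z) k - ip (T f) k) ^+ 2 = 0 by apply/eqP; rewrite eq_le h sqr_ge0.
by rewrite sqrf_eq0 subr_eq0 => /eqP.
Qed.

Lemma cmeas_conj : cmeas Om (fun z => z^*%C).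
Proof.
apply: cmeas_cont => // z _; have := cdiffJ (cdiff_id z).
exact: cdiff_cont.
Qed.

Lemma L2_conj_mul f : L2 f -> L2 (fun z => z^*%C * f z).
Proof.
by apply: (L2M oOm mw w0 cmeas_conj (C := M)) => z oz; rewrite cmodJ; exact: OmM.
Qed.

(** The projection of conj z f onto A^2 is an adjoint image of [f], so the set from which [xget]
    chooses is nonempty. *)
Lemma A2adjointP f : A2 f -> A2 (A2adjoint Om w T f) /\
  forall h, A2 h -> ip (T h) f = ip h (A2adjoint Om w T f).
Proof.
move=> Af; have Lf := A2_L2 Af; have Lzf := L2_conj_mul Lf.
suff [Ag hg] : [set g | A2 g /\ forall h, A2 h -> winner Om w (T h) f = winner Om w h g] (A2adjoint Om w T f).
  by split=> // h /hg; rewrite !winnerE => -[].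
apply: xgetPex; have [g Ag hg] := A2_projection Lzf; have Lg := A2_L2 Ag.
exists g; split=> // h Ah; have Lh := A2_L2 Ah.
have [ATh hT] := toeplitzP Ah.
have key u : A2 u -> ip u (fun z => z^*%C * f z) = ip u g.
  move=> Au; have Lu := A2_L2 Au; have := hg _ Au; rewrite (ipBl oOm mw w0 Lzf Lg Lu) => /eqP; rewrite subr_eq0 => /eqP e.
  by rewrite ipC e ipC.
rewrite !winnerE !hT//; last exact: (L2Z' _ Lf).
rewrite ip_mul key// ip_mul.
have cni : (- 'i%C : R[i])^*%C = 'i%C by apply/eqP; rewrite eq_complex/= opprK oppr0 !eqxx.
(* For the imaginary part, the factor i moves to the other argument as -i, and [key] applies to -i
   h. *)
have -> : ip h (fun z => z^*%C * ('i%C * f z)) = ip (fun z => - 'i%C * h z) (fun z => z^*%C * f z).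
  by rewrite ip_mul; apply: eq_ip => z _ //; rewrite mulrCA cni.
have -> : ip h (fun z => 'i%C * g z) = ip (fun z => - 'i%C * h z) g.
  by rewrite ip_mul; apply: eq_ip => z _ //; rewrite cni.
by rewrite key//; exact: A2Z.
Qed.

Lemma A2opnorm_ge0 S : (0 <= A2opnorm Om w S)%E.
Proof.
apply: (@le_trans _ _ (wnorm Om w (S (fun=> 0)))%:E); first by rewrite lee_fin sqrtr_ge0.
apply: ereal_sup_ubound; exists (fun=> 0) => //; split; first exact: A2_0.
rewrite (wnormE oOm mw w0 L2_0) (_ : ip _ _ = 0) ?sqrtr0//.
by rewrite /ip /Rintegral; under eq_integral do rewrite /ipd /= !mulr0 addr0 mul0r; rewrite integral0.
Qed.

(* <[T^*,T] f, f> = |z f|^2 - |P(conj z f)|^2 = |conj z f - P(conj z f)|^2,   *)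
(* which is at least the squared component of [conj z f] along [g].           *)
Lemma self_commutator_lower_bound f g : A2 f -> ip f f = 1 -> L2 g ->
  (forall h, A2 h -> ip g h = 0) ->
  exists2 r, (r%:E <= A2opnorm Om w (self_commutator Om w T))%E &
    ip g (fun z => z^*%C * f z) ^+ 2 <= sq g * r.
Proof.
move=> Af f1 Lg hg; have Lf := A2_L2 Af.
have [ATf hTf] := toeplitzP Af.
have [Ak hk] := A2adjointP Af; set k := A2adjoint Om w T f in Ak hk.
have [ATk hTk] := toeplitzP Ak.
have [AAT hAT] := A2adjointP ATf.
have Lzf := A2_L2 (A2id Af); have Lk := A2_L2 Ak; have Lcf := L2_conj_mul Lf.
pose d := sq (fun z => z^*%C * f z - k z).
have Lu := L2B' Lcf Lk.
(* [k] plays the part of the projection of conj z f, so [d] is a difference of squared norms by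
   Pythagoras. *)
have kcf : ip k (fun z => z^*%C * f z) = sq k.
  by rewrite -ip_mul -hTk// hk.
have cf2 : sq (fun z => z^*%C * f z) = sq (fun z => z * f z).
  by apply: eq_Rintegral => p _; rewrite !ipdE !cmodM cmodJ.
have dE : d = sq (fun z => z * f z) - sq k.
  by rewrite /d ipBl// ipBr// ipBr// (ipC Om w _ k) kcf cf2; ring.
exists d; last first.
  have -> : ip g (fun z => z^*%C * f z) = ip g (fun z => z^*%C * f z - k z).
    by rewrite ipBr// (hg k)// subr0.
  exact: CS.
have Lc := L2B' (A2_L2 AAT) (A2_L2 ATk).
apply: (@le_trans _ _ (wnorm Om w (self_commutator Om w T f))%:E); last first.
  apply: ereal_sup_ubound; exists f => //; split=> //.
  by rewrite (wnormE oOm mw w0 Lf) f1 sqrtr1.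
rewrite lee_fin (wnormE oOm mw w0 Lc).
have -> : d = ip (self_commutator Om w T f) f.
  rewrite /self_commutator (ipBl oOm mw w0 (A2_L2 AAT) (A2_L2 ATk) Lf) (ipC Om w (A2adjoint Om w T (T f))) -hAT// hk// dE.
  by rewrite (hTf _ (A2_L2 ATf)) (ipC Om w (fun z => z * f z) (T f)) (hTf _ Lzf).
apply: le_trans (ler_norm _) _.
rewrite -sqrtr_sqr ler_wsqrtr//; apply: le_trans (CS Lc Lf) _.
by rewrite f1 mulr1.
Qed.

End bergman.

(** * The zero set of a function with nonvanishing delbar *)

Section zero_set.
Variable R : realType.
Local Notation leb := (@lebesgue_measure R).
Local Notation leb2 := (leb \x leb)%E.
Implicit Types (A : set (measurableTypeR R * measurableTypeR R)) (F f u : R[i]^o -> R[i]^o).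

Lemma null_xsection A : measurable A -> (forall x, countable (xsection A x)) -> leb2 A = 0.
Proof.
move=> mA hA; rewrite /product_measure1; apply: integral0_eq => x _ /=.
exact: countable_lebesgue_measure0.
Qed.

(** The iterated integral in the other order defines the same measure, by uniqueness of the product
    measure. *)
Lemma null_ysection A : measurable A -> (forall y, countable (ysection A y)) -> leb2 A = 0.
Proof.
move=> mA hA; rewrite (@product_measure_unique _ _ _ _ _ leb leb (leb \x^ leb)%E)//.
  rewrite /product_measure2; apply: integral0_eq => x _ /=.
  exact: countable_lebesgue_measure0.
by move=> B C mB mC; exact: product_measure2E.
Qed.

(** Along [d] the linear term has size |t| |L| with L nonzero, while the remainder is at most half
    of it for small t. *)
Lemma cdiff_isolated_zero F z a b (d : R[i]^o) : cdiff F z a b -> F z = 0 -> cmod d = 1 ->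
  a * d + b * d^*%C != 0 ->
  exists2 e : R, 0 < e & forall t : R, t != 0 -> `|t| < e -> F (z + t%:C * d) <> 0.
Proof.
move=> hF F0 d1 L0; set L := a * d + b * d^*%C in L0.
have cL : 0 < cmod L / 2.
  by rewrite divr_gt0// lt_neqAle cmod_ge0 andbT eq_sym; apply: contra L0 => /eqP/cmod_eq0/eqP.
have [e e0 he] := hF _ cL; exists e => // t t0 te Ft.
have E : z + t%:C * d - z = t%:C * d by rewrite addrC addKr.
have ct : cmod (t%:C * d) = `|t| by rewrite cmodM cmodR d1 mulr1.
have := he (z + t%:C * d); rewrite E ct => /(_ te); rewrite Ft F0 subrr sub0r cmodN.
have -> : a * (t%:C * d) + b * (t%:C * d)^*%C = t%:C * L.
  have -> : (t%:C * d)^*%C = t%:C * d^*%C.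
    by case: (d) => ? ?; apply/eqP; rewrite eq_complex/=; apply/andP; split; apply/eqP; ring.
  by rewrite /L; ring.
rewrite cmodM cmodR mulrC ler_pM2r ?normr_gt0//; lra.
Qed.

Lemma countable_isolated_points (S : set R) :
  (forall x, S x -> exists2 e : R, 0 < e & forall t, t != 0 -> `|t| < e -> ~ S (x + t)) ->
  countable S.
Proof.
move=> hS; have <- : isolated S = S; last exact: countable_isolated.
apply/seteqP; split=> x; first by case; rewrite inE.
move=> Sx; split; first by rewrite inE.
have [e e0 he] := hS _ Sx; exists (ball x e); first exact: nbhsx_ballx.
apply/seteqP; split=> y /=; last by move=> ->; split=> //; exact: ballxx.
move=> [xy Sy]; apply/eqP; apply/negPn/negP => yx.
apply: (he (y - x)); rewrite ?subr_eq0//; first by move: xy; rewrite /ball/= distrC.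
by rewrite addrC subrK.
Qed.

Lemma del_delbarD F z : del F z + delbar F z = dx F z.
Proof. by rewrite /del /delbar; field. Qed.

Lemma del_delbarB F z : (del F z - delbar F z) * 'i%C = dy F z.
Proof.
have ii : 'i%C * 'i%C = -1 :> R[i] by rewrite -expr2 sqr_i.
have -> : (del F z - delbar F z) * 'i%C = - ('i%C * 'i%C) * dy F z by rewrite /del /delbar; field.
by rewrite ii opprK mul1r.
Qed.

(* Where [F = 0], one of the two partial derivatives of [F] does not vanish,  *)
(* so the point is isolated in the horizontal or in the vertical section.     *)
Lemma null_zero_set (Om : set R[i]^o) F : open Om -> class_C 1 Om F ->
  (forall z, Om z -> delbar F z != 0) ->
  exists A, [/\ measurable A, leb2 A = 0 & forall p, Om (of_xy p) -> F (of_xy p) = 0 -> A p].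
Proof.
move=> oOm cF dF; have [_ cx cy] := cF.
have cc z : Om z -> {for z, continuous F} by move=> oz; exact: cdiff_cont (class_C1_cdiff oOm cF oz).
have mD := open_measurable_xy oOm.
have mz (G : R[i]^o -> R[i]^o) : (forall z, Om z -> {for z, continuous G}) ->
    measurable ([set p | Om (of_xy p) /\ G (of_xy p) = 0] : set (measurableTypeR R * measurableTypeR R)).
  move=> cG; have [m1 m2] := cmeas_cont oOm cG.
  have -> : [set p : R * R | Om (of_xy p) /\ G (of_xy p) = 0] =
    (@of_xy R @^-1` Om `&` (fun p => complex.Re (G (of_xy p))) @^-1` [set 0]) `&`
    (@of_xy R @^-1` Om `&` (fun p => complex.Im (G (of_xy p))) @^-1` [set 0]).
    apply/seteqP; split => p /=; first by move=> [op ->].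
    by move=> [[op h1] [_ h2]]; split => //; apply/eqP; rewrite eq_complex h1 h2 /= !eqxx.
  by apply: measurableI; [apply: m1|apply: m2] => //; exact: measurable_set1.
have mF := mz _ cc.
pose A1 := [set p | Om (of_xy p) /\ F (of_xy p) = 0] `\` [set p | Om (of_xy p) /\ dx F (of_xy p) = 0].
pose A2 := [set p | Om (of_xy p) /\ F (of_xy p) = 0] `\` [set p | Om (of_xy p) /\ dy F (of_xy p) = 0].
have mA1 : measurable (A1 : set (measurableTypeR R * measurableTypeR R)) by apply: measurableD => //; exact: mz.
have mA2 : measurable (A2 : set (measurableTypeR R * measurableTypeR R)) by apply: measurableD => //; exact: mz.
have z1 : leb2 A1 = 0.
  apply: null_ysection => // y; apply: countable_isolated_points => x.
  rewrite /ysection/= inE => -[/= [oz Fz] nz].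
  have [||e e0 he] := cdiff_isolated_zero (d := 1) (class_C1_cdiff oOm cF oz) Fz.
  - by rewrite cmodE/= expr0n/= addr0 expr1n sqrtr1.
  - by rewrite rmorph1 !mulr1 del_delbarD; apply/eqP => h; exact: nz.
  exists e => // t t0 te; rewrite inE => -[/= [_ Ft] _]; apply: (he t t0 te).
  by rewrite -Ft; congr F; apply/eqP; rewrite eq_complex/=; apply/andP; split; apply/eqP; rewrite /=; ring.
have z2 : leb2 A2 = 0.
  apply: null_xsection => // x; apply: countable_isolated_points => y.
  rewrite /xsection/= inE => -[/= [oz Fz] nz].
  have [||e e0 he] := cdiff_isolated_zero (d := 'i%C) (class_C1_cdiff oOm cF oz) Fz.
  - by rewrite cmodE/= expr0n/= add0r expr1n sqrtr1.
  - have -> : ('i%C : R[i])^*%C = - 'i%C by apply/eqP; rewrite eq_complex/= oppr0 !eqxx.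
    by rewrite mulrN -mulrBl del_delbarB; apply/eqP => h; exact: nz.
  exists e => // t t0 te; rewrite inE => -[/= [_ Ft] _]; apply: (he t t0 te).
  by rewrite -Ft; congr F; apply/eqP; rewrite eq_complex/=; apply/andP; split; apply/eqP; rewrite /=; ring.
exists (A1 `|` A2); split; first exact: measurableU.
  exact (etrans (measureU0 mA1 mA2 z2) z1).
move=> p op Fp; have [hx|hx] := pselect (dx F (of_xy p) = 0).
  right; split; first exact (conj op Fp).
  move=> [_ hy]; move: (dF _ op).
  have -> : delbar F (of_xy p) = (dx F (of_xy p) + 'i%C * dy F (of_xy p)) / 2 by [].
  by rewrite hx hy mulr0 addr0 mul0r eqxx.
left; split; first exact (conj op Fp).
by move=> [_].
Qed.

End zero_set.

(** * Continuity rules and Green's formula against test functions *)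

Section test_functions.
Variable R : realType.
Local Notation leb := (@lebesgue_measure R).
Local Notation leb2 := (leb \x leb)%E.
Implicit Types (f g u b : R[i]^o -> R[i]^o) (z : R[i]^o) (Om K : set R[i]^o).

Lemma ccont_near f g z : (exists2 e : R, 0 < e & forall y, cmod (y - z) < e -> f y = g y) ->
  {for z, continuous g} -> {for z, continuous f}.
Proof.
move=> [e e0 fg] /ccontP h; apply/ccontP => e1 /h[d d0 hd].
exists (Num.min d e); first by rewrite lt_min d0.
move=> y; rewrite lt_min => /andP[yd ye]; rewrite !fg//; first exact: hd.
by rewrite subrr cmod0.
Qed.

Lemma ccontJ f z : {for z, continuous f} -> {for z, continuous (fun y => (f y)^*%C : R[i]^o)}.
Proof.
move=> /ccontP h; apply/ccontP => e /h[d d0 hd]; exists d => // y /hd.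
by rewrite -rmorphB cmodJ.
Qed.

Lemma ccontD f g z : {for z, continuous f} -> {for z, continuous g} ->
  {for z, continuous (fun y => f y + g y)}.
Proof.
move=> /ccontP hf /ccontP hg; apply/ccontP => e e0.
have e20 : 0 < e / 2 by rewrite divr_gt0.
have [d1 d10 h1] := hf _ e20; have [d2 d20 h2] := hg _ e20.
exists (Num.min d1 d2); first by rewrite lt_min d10.
move=> y; rewrite lt_min => /andP[{}/h1 h1 {}/h2 h2].
rewrite opprD addrACA; apply: le_lt_trans (cmodD _ _) _; lra.
Qed.

Lemma ccontM f g z : {for z, continuous f} -> {for z, continuous g} ->
  {for z, continuous (fun y => f y * g y)}.
Proof.
move=> /ccontP hf /ccontP hg; apply/ccontP => e e0.
pose C := 1 + cmod (f z) + cmod (g z).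
have C1 : 1 <= C by rewrite /C -addrA lerDl addr_ge0 ?cmod_ge0.
have C0 : 0 < C by apply: lt_le_trans C1.
pose e' := Num.min 1 (e / (3 * C)).
have e'0 : 0 < e' by rewrite lt_min ltr01 divr_gt0// mulr_gt0.
have [d1 d10 h1] := hf _ e'0; have [d2 d20 h2] := hg _ e'0.
exists (Num.min d1 d2); first by rewrite lt_min d10.
move=> y; rewrite lt_min => /andP[{}/h1 h1 {}/h2 h2].
have -> : f y * g y - f z * g z = (f y - f z) * (g y - g z) + (f y - f z) * g z + f z * (g y - g z) by ring.
apply: le_lt_trans (cmodD _ _) _; apply: le_lt_trans (lerD (cmodD _ _) (lexx _)) _.
rewrite !cmodM.
have e'1 : e' <= 1 by rewrite ge_min lexx.
have e'2 : e' * (3 * C) <= e by rewrite -ler_pdivlMr ?mulr_gt0// ge_min lexx orbT.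
have i1 : cmod (f y - f z) * cmod (g y - g z) < e' * C.
  apply: (@lt_le_trans _ _ (e' * e')); first by rewrite ltr_pM ?cmod_ge0.
  by rewrite ler_wpM2l ?(ltW e'0)// (le_trans e'1).
have i2 : cmod (f y - f z) * cmod (g z) <= e' * C.
  apply: ler_pM; rewrite ?cmod_ge0// ?ltW// /C; have := cmod_ge0 (f z); lra.
have i3 : cmod (f z) * cmod (g y - g z) <= C * e'.
  apply: ler_pM; rewrite ?cmod_ge0//; last exact: ltW.
  by rewrite /C; have := cmod_ge0 (g z); lra.
lra.
Qed.

Lemma ccontZ (c : R[i]^o) f z : {for z, continuous f} -> {for z, continuous (fun y => c * f y)}.
Proof. by move=> cf; exact (ccontM (cdiff_cont (cdiff_cst c z)) cf). Qed.

Lemma compact_ccont_bounded K f : compact K -> (forall z, K z -> {for z, continuous f}) ->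
  exists2 C : R, 0 < C & forall z, K z -> cmod (f z) < C.
Proof.
move=> cK cf; have [|C C0 hC] := @compact_cbounded _ (f @` K).
  apply: continuous_compact => //; apply: continuous_in_subspaceT => z.
  by rewrite inE => /cf.
by exists C => // z Kz; apply: hC; exists z.
Qed.

Lemma class_C1_ccont Om f z : open Om -> class_C 1 Om f -> Om z ->
  [/\ {for z, continuous f}, {for z, continuous (del f)} & {for z, continuous (delbar f)}].
Proof.
move=> oOm cf oz; have [_ /(_ z oz) cx /(_ z oz) cy] := cf; split.
- exact: cdiff_cont (class_C1_cdiff oOm cf oz).
- rewrite (_ : del f = fun y => 2^-1 * (dx f y + (- 'i%C) * dy f y)); last first.
    by apply/funext => y; rewrite /del mulrC mulNr.
  exact (ccontZ (ccontD cx (ccontZ cy))).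
- rewrite (_ : delbar f = fun y => 2^-1 * (dx f y + 'i%C * dy f y)); last first.
    by apply/funext => y; rewrite /delbar mulrC.
  exact (ccontZ (ccontD cx (ccontZ cy))).
Qed.

Lemma del_near0 f z : (exists2 e : R, 0 < e & forall y, cmod (y - z) < e -> f y = 0) ->
  dx f z = 0 /\ dy f z = 0.
Proof.
move=> [e e0 fz].
have dir0 (d : R[i]) (P : R[i] -> R) : cmod d = 1 -> P 0 = 0 ->
    derive1 (fun t : R => P (f (z + t%:C * d))) 0 = 0.
  move=> d1 P0; rewrite derive1E.
  have -> : 'D_1 (fun t : R => P (f (z + t%:C * d))) 0 = 'D_1 (cst (0 : R)) (0 : R).
    apply: near_eq_derive; apply/nbhs_ballP; exists e => // t.
    by rewrite /ball/= sub0r normrN => te; rewrite fz ?P0// addrC addKr cmodM d1 mulr1 cmodR.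
  by rewrite derive_cst.
have dd0 (d : R[i]) : cmod d = 1 -> dir_derive d f z = 0.
  move=> d1; rewrite /dir_derive.
  have /= -> := dir0 d (fun c : R[i] => complex.Re c) d1 erefl.
  by have /= -> := dir0 d (fun c : R[i] => complex.Im c) d1 erefl.
split; apply: dd0; rewrite cmodE/= expr0n/= ?addr0 ?add0r expr1n sqrtr1//.
Qed.

Lemma test_functionP Om f : test_function Om f -> class_C 1 setT f /\
  exists K, [/\ compact K, K `<=` Om & forall z, ~ K z -> [/\ f z = 0, del f z = 0 & delbar f z = 0]].
Proof.
move=> [hf [K [cK KOm fK]]]; split; first exact: hf.
exists K; split=> // z nKz.
have [|x0 y0] := @del_near0 f z.
  have [e e0 he] := (open_cP _).1 (compact_open_setC cK) z nKz.
  by exists e => // y /he/fK.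
by rewrite /del /delbar x0 y0 !mulr0 subr0 addr0 mul0r; split=> //; exact: fK.
Qed.

(** The integrand is delbar of conj f * u, since delbar (conj f) is the conjugate of del f. This
    product vanishes off the support of [f], so it is differentiable on the whole plane and
    [green_plane] applies. *)
Lemma test_green Om f u b : open Om -> test_function Om f ->
  (forall z, Om z -> exists a, cdiff u z a (b z)) -> (forall z, Om z -> {for z, continuous b}) ->
  \int[leb2]_(p in @of_xy R @^-1` Om)
    complex.Re ((del f (of_xy p))^*%C * u (of_xy p) + (f (of_xy p))^*%C * b (of_xy p)) = 0.
Proof.
move=> oOm tf du cb; have [cf [K [cK KOm fK]]] := test_functionP tf.
have cd z : cdiff f z (del f z) (delbar f z) by exact: class_C1_cdiff openT cf I.
have oKC := (open_cP _).1 (compact_open_setC cK).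
pose P z : R[i]^o := (f z)^*%C * u z.
pose Q z : R[i]^o := (del f z)^*%C * u z + (f z)^*%C * b z.
have QK z : ~ K z -> Q z = 0.
  by move=> /fK[fz dfz _]; rewrite /Q fz dfz rmorph0 !mul0r addr0.
have PK z : ~ K z -> P z = 0 by move=> /fK[fz _ _]; rewrite /P fz rmorph0 mul0r.
have dP z : exists a, cdiff P z a (Q z).
  have [Kz|nKz] := pselect (K z).
    have [a ha] := du _ (KOm _ Kz); have := cdiffM (cdiffJ (cd z)) ha.
    by eexists; eassumption.
  exists 0; rewrite QK//; apply: (@cdiff_near _ _ (fun=> 0)); last exact: cdiff0.
  by have [e e0 he] := oKC _ nKz; exists e => // y /he/PK.
have cQ z : {for z, continuous Q}.
  have [Kz|nKz] := pselect (K z).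
    have oz := KOm _ Kz; have [c1 c2 _] := class_C1_ccont openT cf (I : setT z).
    have [a /cdiff_cont cu] := du _ oz.
    exact (ccontD (ccontM (ccontJ c2) cu) (ccontM (ccontJ c1) (cb _ oz))).
  apply: (@ccont_near _ (fun=> 0)); last exact: cdiff_cont (cdiff0 z).
  by have [e e0 he] := oKC _ nKz; exists e => // y /he/QK.
have [C C0 hC] := compact_ccont_bounded cK (fun z _ => cQ z).
have [N N0 hN] := compact_cbounded cK.
have := @green_plane R P Q (C + N) dP cQ.
move=> <-.
- rewrite [LHS]Rintegral_mkcond; apply: eq_Rintegral => p _; rewrite patchE.
  by case: ifPn => //; rewrite notin_setE /= => nD; rewrite QK//= => /KOm.
- move=> z; have [/hC Kz|/QK ->] := pselect (K z); first lra.
  by rewrite cmod0; lra.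
- move=> z hz; suff nK : ~ K z by split; [exact: PK|exact: QK].
  by move=> /hN; lra.
Qed.

Lemma measurable_funV_ge0 (D : set (measurableTypeR R * measurableTypeR R)) (h : measurableTypeR R * measurableTypeR R -> R) :
  measurable_fun D h -> (forall p, D p -> 0 <= h p) -> measurable_fun D (fun p => (h p)^-1).
Proof.
move=> mh h0; apply: (eq_measurable_fun (fun p => h p `^ (-1))).
  by move=> p /[1!inE] Dp; rewrite powR_inv1// h0.
by apply: (measurableT_comp (measurable_powR _)).
Qed.

End test_functions.

(** * Measurability of the weight *)

Section weight_measurable.
Variable R : realType.
Implicit Types (phi : R[i]^o -> R[i]^o) (Om : set R[i]^o).

(** The derivative is the pointwise limit of difference quotients with step 1 / (n + 1). Each is
    continuous on the open set [On n] where both points lie in [Om], and is extended by zero. *)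
Lemma measurable_derive1 Om phi : open Om -> holomorphic Om phi -> cmeas Om (derive1 phi).
Proof.
move=> oOm hphi.
pose d n : R[i]^o := (n.+1%:R^-1 : R)%:C.
pose psi n z : R[i]^o := (n.+1%:R : R)%:C * (phi (z + d n) - phi z).
pose On n := Om `&` [set z | Om (z + d n)].
have oOn n : open (On n).
  apply/open_cP => z [oz ozd].
  have [e1 e10 h1] := (open_cP _).1 oOm _ oz; have [e2 e20 h2] := (open_cP _).1 oOm _ ozd.
  exists (Num.min e1 e2); first by rewrite lt_min e10.
  move=> y; rewrite lt_min => /andP[/h1 ? y2]; split=> //; apply: h2.
  by rewrite opprD addrACA subrr addr0.
have cpsi n z : On n z -> {for z, continuous (psi n)}.
  move=> [oz ozd].
  have c1 : {for z, continuous (fun y => phi (y + d n))}.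
    have /ccontP h := holomorphic_continuous hphi ozd.
    apply/ccontP => e /h[r r0 hr]; exists r => // y yz; apply: hr.
    by rewrite opprD addrACA subrr addr0.
  have c2 := ccontZ (c := -1) (holomorphic_continuous hphi oz).
  have -> : psi n = fun y => (n.+1%:R : R)%:C * (phi (y + d n) + -1 * phi y).
    by apply/funext => y; rewrite mulN1r.
  exact (ccontZ (ccontD c1 c2)).
have mpsi n := cmeas_cont (oOn n) (cpsi n).
pose D := @of_xy R @^-1` Om.
have mD := open_measurable_xy oOm : measurable (D : set (measurableTypeR R * measurableTypeR R)).
pose Dn n := @of_xy R @^-1` (On n).
have mDn n := open_measurable_xy (oOn n) : measurable (Dn n : set (measurableTypeR R * measurableTypeR R)).
have part (P : R[i] -> R) : (forall n, measurable_fun (Dn n) (fun p : measurableTypeR R * measurableTypeR R => P (psi n (of_xy p)))) ->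
  (forall u v, `|P u - P v| <= cmod (u - v)) ->
  measurable_fun D (fun p : measurableTypeR R * measurableTypeR R => P (derive1 phi (of_xy p))).
  move=> mP PB.
  apply: (@measurable_fun_cvg _ _ _ _ (fun n => (fun p => P (psi n (of_xy p))) \_ (Dn n))).
    move=> n; apply: (measurable_restrict _ (mDn n) mD).1.
    exact (measurable_funS (mDn n) (@subIsetr _ D (Dn n)) (mP n)).
  move=> p Dp; apply/(@cvgrPdist_lt _ R^o) => e e0.
  have [r r0 hr] := (open_cP _).1 oOm _ Dp.
  have e20 : 0 < e / 2 by rewrite divr_gt0.
  have [s s0 hs] := holomorphic_cdiff hphi Dp e20.
  have rs0 : 0 < Num.min r s by rewrite lt_min r0.
  have [N _ hN] := near_infty_natSinv_lt (PosNum rs0).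
  exists N => // n /= Nn; have := hN n Nn; rewrite /= lt_min => /andP[nr ns].
  have cdn : cmod (d n) = n.+1%:R^-1 by rewrite cmodR ger0_norm.
  have Dnp : Dn n p.
    split=> //=; apply: hr; by rewrite addrC addKr cdn.
  rewrite patchE ifT ?inE//.
  apply: le_lt_trans (PB _ _) _.
  have := hs (of_xy p + d n); rewrite addrC addKr cdn => /(_ ns).
  rewrite mul0r addr0 => h.
  have n0 : (n.+1%:R : R) != 0 by rewrite pnatr_eq0.
  have -> : derive1 phi (of_xy p) - psi n (of_xy p) =
    - ((n.+1%:R : R)%:C * (phi (of_xy p + d n) - phi (of_xy p) - derive1 phi (of_xy p) * d n)).
    have key : (n.+1%:R : R)%:C * (derive1 phi (of_xy p) * d n) = derive1 phi (of_xy p).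
      by rewrite mulrCA /d -rmorphM/= divff// mulr1.
    by rewrite [in RHS]mulrBr key opprB.
  rewrite cmodN cmodM cmodR ger0_norm//.
  apply: (@le_lt_trans _ _ (n.+1%:R * (e / 2 * n.+1%:R^-1))).
    by rewrite ler_wpM2l.
  by rewrite mulrCA divff// mulr1; lra.
split; apply: part.
- by move=> n; have [] := mpsi n.
- by move=> a b; rewrite -raddfB; exact: cmod_Re.
- by move=> n; have [] := mpsi n.
- by move=> a b; rewrite -raddfB; exact: cmod_Im.
Qed.

Lemma measurable_cmod Om f : cmeas Om f ->
  measurable_fun (@of_xy R @^-1` Om) (fun p : measurableTypeR R * measurableTypeR R => cmod (f (of_xy p))).
Proof.
move=> [f1 f2]; under eq_fun do rewrite cmodE.
apply: (measurableT_comp (@continuous_measurable_fun R _ (@sqrt_continuous R))).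
by apply: measurable_funD; exact: measurable_funX.
Qed.

Lemma measurable_weight Om phi alpha : open Om -> holomorphic Om phi ->
  measurable_fun (@of_xy R @^-1` Om)
    (fun p : measurableTypeR R * measurableTypeR R => weight alpha phi (of_xy p)).
Proof.
move=> oOm hphi.
have m1 : measurable_fun (@of_xy R @^-1` Om)
    (fun p : measurableTypeR R * measurableTypeR R => cmod (phi (of_xy p))).
  exact (measurable_cmod (cmeas_cont oOm (fun z oz => holomorphic_continuous hphi oz))).
have m2 := measurable_cmod (measurable_derive1 oOm hphi).
apply: measurable_funM.
  apply: measurable_funM; first exact: measurable_cst.
  apply: (measurableT_comp (measurable_powR _)).
  by apply: measurable_funB; [exact: measurable_cst|exact: measurable_funX].
apply: measurable_funV_ge0; last by move=> p _; exact: powR_ge0.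
exact: (measurableT_comp (measurable_powR _)).
Qed.

Lemma weight_ge0 phi alpha z : -1 < alpha -> 0 <= weight alpha phi z.
Proof.
move=> a1; rewrite /weight divr_ge0 ?powR_ge0// mulr_ge0 ?powR_ge0//; lra.
Qed.

End weight_measurable.

(** * Energy identities for the flux *)

Section energy.
Variables (R : realType) (Om : set R[i]^o) (w : R[i]^o -> R) (M : R) (v : R[i]^o -> R[i]^o).
Local Notation leb := (@lebesgue_measure R).
Local Notation leb2 := (leb \x leb)%E.
Local Notation RR := (measurableTypeR R * measurableTypeR R)%type.
Local Notation D := (@of_xy R @^-1` Om).
Hypothesis oOm : open Om.
Hypothesis mw : measurable_fun D (fun p : RR => w (of_xy p)).
Hypothesis w0 : forall z, Om z -> 0 <= w z.
Hypothesis OmM : forall z, Om z -> cmod z <= M.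
Hypothesis v_sol : dirichlet_solution Om w v.
Implicit Types (f h u q : R[i]^o -> R[i]^o) (z : R[i]^o).
Local Notation L2 := (L2w Om w).
Local Notation ip := (ip Om w).
Local Notation sq f := (ip f f).
Local Notation g := (wflux w v).

Let mD : measurable (D : set RR). Proof. exact: open_measurable_xy. Qed.

Lemma finite_measure_D : exists m, leb2 D = m%:E.
Proof.
pose N : R := `|M| + 1; have N0 : 0 < N + N by rewrite /N; have := normr_ge0 M; lra.
have sub : D `<=` rect (- N) (- N) (N + N).
  move=> [x y] /OmM h; split; rewrite /= in_itv/=.
    have := le_trans (cmod_Re _) h; rewrite /= ler_norml /N; have := ler_norm M; lra.
  have := le_trans (cmod_Im _) h; rewrite /= ler_norml /N; have := ler_norm M; lra.
exists (fine (leb2 D)); rewrite fineK// ge0_fin_numE; last exact: measure_ge0.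
apply: le_lt_trans (le_measure leb2 _ _ sub) _; rewrite ?inE//; first exact: measurable_rect.
exact (eq_ind_r (fun t => (t < +oo)%E) (ltry _) (leb2_rect (- N) (- N) N0)).
Qed.

Lemma bounded_integrable_D (h : RR -> R) C : measurable_fun D h ->
  (forall p, D p -> `|h p| <= C) -> leb2.-integrable D (EFin \o h).
Proof.
by move=> mh hC; have [m Dm] := finite_measure_D; exact: (le_bounded_integrable mD Dm mh hC).
Qed.

Lemma compact_integrable_D q K : compact K -> K `<=` Om ->
  (forall z, Om z -> {for z, continuous q}) -> (forall z, ~ K z -> q z = 0) ->
  leb2.-integrable D (EFin \o (fun p : RR => complex.Re (q (of_xy p)))).
Proof.
move=> cK KOm cq qK; have [C C0 hC] := compact_ccont_bounded cK (fun z Kz => cq z (KOm _ Kz)).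
apply: (@bounded_integrable_D _ C); first by have [] := cmeas_cont oOm cq.
move=> p Dp; apply: le_trans (cmod_Re _) _.
have [/hC/ltW//|/qK ->] := pselect (K (of_xy p)).
by rewrite cmod0 ltW.
Qed.

Let cv : class_C 1 Om v. Proof. by case: v_sol. Qed.
Let cg : class_C 1 Om g. Proof. by case: v_sol. Qed.

Lemma delbar_flux z : Om z -> delbar g z = - 2^-1.
Proof.
move=> oz; have [_ _ /(_ z oz) h _] := v_sol.
have -> : delbar g z = (4 * delbar g z) / 4 by field.
by rewrite -/(wlaplacian w v z) h; field.
Qed.

(** With the convention 0^-1 = 0 the flux vanishes wherever [w] does; its delbar is the nonzero
    constant -1/2, so its zero set is null. *)
Lemma weight_ae_neq0 : {ae leb2, forall p, D p -> w (of_xy p) != 0}.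
Proof.
have [|A [mA A0 hA]] := null_zero_set oOm cg.
  by move=> z oz; rewrite delbar_flux// oppr_eq0 invr_eq0 pnatr_eq0.
exists A; split=> // p /= hp; apply: hA; first by apply: contrapT => nD; apply: hp => /nD.
apply/eqP; apply: contrapT => gp; apply: hp => _; apply/negP => /eqP wp; apply: gp.
by rewrite /wflux wp invr0 mul0r.
Qed.

Lemma cmeas_winv : cmeas Om (fun z => (w z)^-1%:C : R[i]^o).
Proof. by split; [exact (measurable_funV_ge0 mw (fun p Dp => w0 Dp))|exact: measurable_cst]. Qed.

Lemma cmeas_wflux f : class_C 1 Om f -> cmeas Om (wflux w f).
Proof.
move=> cf; apply: cmeasM; first exact: cmeas_winv.
by apply: (cmeas_cont oOm) => z oz; have [] := class_C1_ccont oOm cf oz.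
Qed.

Lemma test_class_C1 f : test_function Om f -> class_C 1 Om f.
Proof.
move=> /test_functionP[[h1 h2 h3] _]; split=> [z _|z _|z _]; [exact: h1|exact: h2|exact: h3].
Qed.

Lemma measurable_energy f : class_C 1 Om f ->
  measurable_fun D (fun p : RR => cmod (del v (of_xy p) - del f (of_xy p)) ^+ 2 / w (of_xy p)).
Proof.
move=> cf; apply: measurable_funM; last exact (measurable_funV_ge0 mw (fun p Dp => w0 Dp)).
apply: measurable_funX; apply: (measurable_cmod (f := fun z => del v z - del f z)).
have m1 : cmeas Om (del v) by apply: (cmeas_cont oOm) => z oz; have [] := class_C1_ccont oOm cv oz.
have m2 : cmeas Om (del f) by apply: (cmeas_cont oOm) => z oz; have [] := class_C1_ccont oOm cf oz.
have := cmeasD m1 (cmeasM (cmeas_cst Om (-1)) m2).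
by under eq_fun do rewrite mulN1r.
Qed.

(* The energy of [v] is finite: on the support of a nearby test function it   *)
(* is controlled by the continuity of the flux, elsewhere by the distance to  *)
(* the test function.                                                         *)
Lemma L2_flux : L2 g.
Proof.
have [_ _ _ /(_ 1 ltr01)[f [tf _ hf]]] := v_sol.
have [m Dm] := finite_measure_D.
have [_ [K [cK KOm fK]]] := test_functionP tf.
have [C1 C10 h1] := compact_ccont_bounded cK (fun z Kz => let: And3 c _ _ := class_C1_ccont oOm cg (KOm z Kz) in c).
have [C2 C20 h2] := compact_ccont_bounded cK (fun z Kz => let: And3 _ c _ := class_C1_ccont oOm cv (KOm z Kz) in c).
have [m1 m2] := cmeas_wflux cv; split=> //.
pose F p := cmod (del v (of_xy p) - del f (of_xy p)) ^+ 2 / w (of_xy p).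
have F0 p : D p -> 0 <= F p by move=> Dp; rewrite divr_ge0 ?sqr_ge0// w0.
have mF : measurable_fun D F := measurable_energy (test_class_C1 tf).
have C12 : 0 <= C1 * C2 by rewrite mulr_ge0// ltW.
have pi0 : 0 <= pi^-1 :> R by rewrite invr_ge0 pi_ge0.
apply: (@le_lt_trans _ _ (\int[leb2]_(p in D) ((pi^-1)%:E * ((C1 * C2)%:E + (F p)%:E)))%E).
  apply: ge0_le_integral => //.
  - by move=> p Dp; rewrite lee_fin mulr_ge0 ?sqr_ge0// (wpi_ge0 w0).
  - under eq_fun do rewrite -ipdE; apply/measurable_EFinP; apply: (measurable_ipd mw) => //.
  - apply/measurable_EFinP; apply: measurable_funM; first exact: measurable_cst.
    by apply: measurable_funD => //; exact: measurable_cst.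
  move=> p Dp; rewrite -EFinD -EFinM lee_fin mulrA mulrC ler_wpM2l//.
  have wp := w0 Dp; have gE : cmod (g (of_xy p)) = (w (of_xy p))^-1 * cmod (del v (of_xy p)).
    by rewrite cmodM cmodR ger0_norm// invr_ge0.
  have ww : (w (of_xy p))^-1 * w (of_xy p) <= 1.
    by have [->|wn] := eqVneq (w (of_xy p)) 0; [rewrite mulr0|rewrite mulVf].
  have [Kp|nKp] := pselect (K (of_xy p)).
    apply: (@le_trans _ _ (C1 * C2)); last by rewrite lerDl F0.
    have -> : cmod (g (of_xy p)) ^+ 2 * w (of_xy p) =
      cmod (g (of_xy p)) * cmod (del v (of_xy p)) * ((w (of_xy p))^-1 * w (of_xy p)).
      by rewrite expr2 {2}gE; ring.
    rewrite -[leRHS]mulr1; apply: ler_pM; rewrite ?mulr_ge0 ?cmod_ge0 ?invr_ge0//.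
    by apply: ler_pM; rewrite ?cmod_ge0// ltW// ?h1 ?h2.
  apply: (@le_trans _ _ (F p)); last by rewrite lerDr.
  have [_ fz _] := fK _ nKp; rewrite /F fz subr0 gE.
  have [->|wn] := eqVneq (w (of_xy p)) 0; first by rewrite invr0 !mulr0.
  by rewrite le_eqVlt; apply/orP; left; apply/eqP; field.
rewrite ge0_integralZl//; last first.
- by move=> p Dp; rewrite lee_fin addr_ge0// F0.
- by apply/measurable_EFinP; apply: measurable_funD => //; exact: measurable_cst.
rewrite ge0_integralD//; last exact/measurable_EFinP.
apply: lte_mul_pinfty; rewrite ?lee_fin//.
apply: lte_add_pinfty; last by apply: lt_trans hf _; rewrite ltry.
rewrite integral_cst//.
apply: lte_mul_pinfty; rewrite ?lee_fin//.
exact (eq_ind_r (fun t => (t < +oo)%E) (ltry m) Dm).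
Qed.

(** The energy distance of [v] and [f] is pi times the squared weighted norm of the difference of
    their fluxes. At zeros of [w] both densities are 0. *)
Lemma flux_distance f e : test_function Om f ->
  (area_integral Om (fun z => (cmod (del v z - del f z) ^+ 2 / w z)%:E) < e%:E)%E ->
  L2 (wflux w f) /\ pi * sq (fun z => g z - wflux w f z) < e.
Proof.
move=> tf hf; have cf := test_class_C1 tf.
have mg := cmeas_wflux cv; have mf := cmeas_wflux cf.
have pi0 : 0 < pi :> R by exact: pi_gt0.
pose F p := cmod (del v (of_xy p) - del f (of_xy p)) ^+ 2 / w (of_xy p).
have mF : measurable_fun D F := measurable_energy cf.
have F0 p : D p -> 0 <= F p by move=> Dp; rewrite divr_ge0 ?sqr_ge0// w0.
have E : (pi%:E * wnorm2 Om w (fun z => g z - wflux w f z)%R)%E =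
    area_integral Om (fun z => (cmod (del v z - del f z) ^+ 2 / w z)%:E).
  rewrite /wnorm2 /area_integral -ge0_integralZl//.
  - apply: eq_integral => p /[1!inE] Dp; rewrite -EFinM; congr EFin.
    have -> : g (of_xy p) - wflux w f (of_xy p) = (w (of_xy p))^-1%:C * (del v (of_xy p) - del f (of_xy p)).
      by rewrite /wflux mulrBr.
    rewrite cmodM cmodR; have wp := w0 Dp; rewrite ger0_norm ?invr_ge0//.
    have [->|wn] := eqVneq (w (of_xy p)) 0; first by rewrite invr0 !(mul0r, mulr0).
    by move: (pi : R) pi0 => q q0; field; rewrite wn gt_eqF.
  - under eq_fun do rewrite -(ipdE w (fun z => g z - wflux w f z)).
    apply/measurable_EFinP; apply: (measurable_ipd mw).
      have := cmeasD mg (cmeasM (cmeas_cst Om (-1)) mf).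
      by under eq_fun do rewrite mulN1r.
    have := cmeasD mg (cmeasM (cmeas_cst Om (-1)) mf).
    by under eq_fun do rewrite mulN1r.
  - by move=> p Dp; rewrite lee_fin mulr_ge0 ?sqr_ge0// (wpi_ge0 w0).
  - by rewrite lee_fin ltW.
have Ld : L2 (fun z => g z - wflux w f z).
  have [d1 d2] : cmeas Om (fun z => g z - wflux w f z).
    have := cmeasD mg (cmeasM (cmeas_cst Om (-1)) mf).
    by under eq_fun do rewrite mulN1r.
  split=> //; rewrite ltey; apply/negP => /eqP h.
  by move: hf; rewrite -E h mulry gtr0_sg// mul1e ltNge leey.
split; last by rewrite -lte_fin EFinM -(wnorm2E oOm mw w0 Ld) E.
have := L2B oOm mw w0 L2_flux Ld.
by under eq_fun do rewrite opprB addrC subrK.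
Qed.

(** The factor 1/w of the flux cancels the weight of the measure, almost everywhere by
    [weight_ae_neq0]. *)
Lemma ip_flux_test f u : test_function Om f -> L2 (wflux w f) -> L2 u ->
  pi * ip (wflux w f) u = \int[leb2]_(p in D) complex.Re ((del f (of_xy p))^*%C * u (of_xy p)).
Proof.
move=> tf Lf Lu; have pi0 : pi != 0 :> R by rewrite gt_eqF ?pi_gt0.
rewrite -RintegralZl//; last exact: (integrable_ipd oOm mw w0).
rewrite /Rintegral; congr fine; apply: ae_eq_integral => //.
- apply/measurable_EFinP; apply: measurable_funM; first exact: measurable_cst.
  exact (measurable_ipd mw (L2_cmeas mw w0 Lf) (L2_cmeas mw w0 Lu)).
- apply/measurable_EFinP.
  have cf := test_class_C1 tf.
  have m1 : cmeas Om (fun z => (del f z)^*%C).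
    by apply: (cmeas_cont oOm) => z oz; have [_ c _] := class_C1_ccont oOm cf oz; exact: ccontJ.
  by have [] := cmeasM m1 (L2_cmeas mw w0 Lu).
have [A [mA A0 hA]] := weight_ae_neq0; exists A; split=> // p np; apply: hA => hp.
apply: np => Dp; congr EFin; have wp := hp Dp.
rewrite /ipd /wflux; move: (del f _) (u _) => [a b] [c d] /=.
by move: (pi : R) pi0 => q q0; field; rewrite q0 wp.
Qed.

Definition re_integral (f : R[i]^o -> R[i]^o) : R := \int[leb2]_(p in D) complex.Re (f (of_xy p)).

Lemma ip_flux_test_holomorphic f h : test_function Om f -> L2 (wflux w f) -> holomorphic Om h -> L2 h ->
  ip (wflux w f) h = 0.
Proof.
move=> tf Lf hh Lh; have pi0 : pi != 0 :> R by rewrite gt_eqF ?pi_gt0.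
apply: (mulfI pi0); rewrite mulr0 (ip_flux_test tf Lf Lh).
rewrite -(@test_green R Om f h (fun=> 0) oOm tf).
- by apply: eq_Rintegral => p _; rewrite mulr0 addr0.
- by move=> z oz; exists (derive1 h z); exact (holomorphic_cdiff hh oz).
- by move=> z _; exact (cdiff_cont (cdiff_cst 0 z)).
Qed.

Lemma integrable_test f : test_function Om f ->
  leb2.-integrable D (EFin \o (fun p : RR => complex.Re (f (of_xy p)))).
Proof.
move=> tf; have [_ [K [cK KOm fK]]] := test_functionP tf; have cf := test_class_C1 tf.
have cc z : Om z -> {for z, continuous f} by move=> oz; have [c1 _ _] := class_C1_ccont oOm cf oz.
have f0 z : ~ K z -> f z = 0 by move=> /fK[].
exact (compact_integrable_D cK KOm cc f0).
Qed.

(** Green's formula for constant delbar u = c; it serves for conj z, where c = 1, and for the flux,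
    where c = -1/2. *)
Lemma test_integral f u (c : R) : test_function Om f ->
  (forall z, Om z -> exists a, cdiff u z a c%:C) ->
  \int[leb2]_(p in D) complex.Re ((del f (of_xy p))^*%C * u (of_xy p)) = - c * re_integral f.
Proof.
move=> tf du; have [_ [K [cK KOm fK]]] := test_functionP tf; have cf := test_class_C1 tf.
have := @test_green R Om f u (fun=> c%:C) oOm tf du (fun z _ => cdiff_cont (cdiff_cst c%:C z)).
have cc z : Om z -> {for z, continuous (fun z => (f z)^*%C * c%:C : R[i]^o)}.
  by move=> oz; have [c1 _ _] := class_C1_ccont oOm cf oz; exact (ccontM (ccontJ c1) (cdiff_cont (cdiff_cst c%:C z))).
have cd z : Om z -> {for z, continuous (fun z => (del f z)^*%C * u z : R[i]^o)}.
  move=> oz; have [_ c1 _] := class_C1_ccont oOm cf oz; have [a /cdiff_cont c2] := du _ oz.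
  exact (ccontM (ccontJ c1) c2).
have i1 : leb2.-integrable D (EFin \o (fun p : RR => complex.Re ((del f (of_xy p))^*%C * u (of_xy p)))).
  have d0 z : ~ K z -> (del f z)^*%C * u z = 0 by move=> /fK[_ -> _]; rewrite rmorph0 mul0r.
  exact (compact_integrable_D cK KOm cd d0).
have i2 : leb2.-integrable D (EFin \o (fun p : RR => complex.Re ((f (of_xy p))^*%C * c%:C))).
  have f0 z : ~ K z -> (f z)^*%C * c%:C = 0 by move=> /fK[-> _ _]; rewrite rmorph0 mul0r.
  exact (compact_integrable_D cK KOm cc f0).
have i3 := integrable_test tf.
rewrite (_ : (fun p => complex.Re ((del f (of_xy p))^*%C * u (of_xy p) + (f (of_xy p))^*%C * c%:C)) =
  (fun p => complex.Re ((del f (of_xy p))^*%C * u (of_xy p)) + complex.Re ((f (of_xy p))^*%C * c%:C))); last first.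
  by apply/funext => p; rewrite raddfD.
rewrite RintegralD// (_ : (fun p => complex.Re ((f (of_xy p))^*%C * c%:C)) = (fun p => c * complex.Re (f (of_xy p)))).
  by rewrite RintegralZl// => /eqP; rewrite addr_eq0 => /eqP ->; rewrite mulNr.
by apply/funext => p; move: (f _) => [a b] /=; ring.
Qed.

(** The form in which the boundary condition is used: identities known for test functions pass to
    [v], since the flux converges in weighted L^2 and the integral of the real part converges. *)
Lemma flux_approx e : 0 < e -> e < 1 -> exists f, [/\ test_function Om f, L2 (wflux w f),
  sq (fun z => g z - wflux w f z) <= e & `|re_integral v - re_integral f| <= e].
Proof.
move=> e0 e1; have [_ _ _ /(_ e e0)[f [tf hvf hf]]] := v_sol.
have [Lf hpi] := flux_distance tf hf; exists f; split=> //.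
  have pi1 : 1 <= pi :> R by apply: le_trans (pi_ge2 R); lra.
  apply: le_trans (ltW hpi); rewrite ler_peMl//; exact: ip_ge0.
have cf := test_class_C1 tf; have i3 := integrable_test tf.
have mv : cmeas Om v by apply: (cmeas_cont oOm) => z oz; have [] := class_C1_ccont oOm cv oz.
have mf : cmeas Om f by apply: (cmeas_cont oOm) => z oz; have [] := class_C1_ccont oOm cf oz.
have md : measurable_fun D (fun p : RR => complex.Re (v (of_xy p)) - complex.Re (f (of_xy p))).
  by apply: measurable_funB; [case: mv|case: mf].
have le1 : (\int[leb2]_(p in D) `|(complex.Re (v (of_xy p)) - complex.Re (f (of_xy p)))%:E| < e%:E)%E.
  apply: le_lt_trans hvf; apply: ge0_le_integral => //.
  - by apply/measurable_EFinP; exact: measurableT_comp.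
  - apply/measurable_EFinP; apply: (measurable_cmod (f := fun z => v z - f z)).
    have := cmeasD mv (cmeasM (cmeas_cst Om (-1)) mf).
    by under eq_fun do rewrite mulN1r.
  by move=> p _; rewrite lee_fin -raddfB; exact: cmod_Re.
have id : leb2.-integrable D (EFin \o (fun p : RR => complex.Re (v (of_xy p)) - complex.Re (f (of_xy p)))).
  apply/integrableP; split; first exact/measurable_EFinP.
  by apply: lt_trans le1 _; rewrite ltry.
have -> : re_integral v = \int[leb2]_(p in D) ((complex.Re (v (of_xy p)) - complex.Re (f (of_xy p))) + complex.Re (f (of_xy p))).
  by apply: eq_Rintegral => p _; rewrite subrK.
rewrite RintegralD// addrK; apply: le_trans (le_normr_Rintegral mD id) _.
rewrite -lee_fin /Rintegral fineK; first exact: ltW.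
exact: (integrable_fin_num mD (integrable_norm id)).
Qed.

(** Replaces the passage to the limit; e < 1 allows errors of order e^2 to be absorbed into e. *)
Lemma sqr_small_eq0 (x C : R) : (forall e, 0 < e -> e < 1 -> x ^+ 2 <= C * e) -> x = 0.
Proof.
move=> h; apply/eqP; rewrite -sqrf_eq0 eq_le sqr_ge0 andbT leNgt; apply/negP => x0.
have C0 : 0 < C.
  have h2 : 0 < 2^-1 :> R by [].
  have := h 2^-1 h2; rewrite invf_lt1 ?ltr1n// => /(_ isT) h3; have := lt_le_trans x0 h3.
  by rewrite pmulr_lgt0.
pose e := Num.min (2^-1) (x ^+ 2 / (2 * C)).
have e0 : 0 < e by rewrite lt_min invr_gt0 ltr0n/= divr_gt0// mulr_gt0.
have e1 : e < 1 by rewrite gt_min invf_lt1 ?ltr1n.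
have := h e e0 e1; have : e <= x ^+ 2 / (2 * C) by rewrite ge_min lexx orbT.
rewrite ler_pdivlMr ?mulr_gt0//; lra.
Qed.

Lemma sqr_le_small (x e : R) : e <= 1 -> `|x| <= e -> x ^+ 2 <= e.
Proof.
move=> e1 xe; rewrite -real_normK ?num_real// expr2.
apply: le_trans (ler_pM _ _ xe xe) _; rewrite ?normr_ge0//.
by rewrite ler_piMl// (le_trans _ xe).
Qed.

(** The relation is exact for the quantities [y], [b] of a test function; [x], [a] are those of [v],
    and the error in theirs is controlled. *)
Lemma approx_relation (q x y s a b e : R) : q * y = - b -> (x - y) ^+ 2 <= e * s ->
  (a - b) ^+ 2 <= e -> (q * x + a) ^+ 2 <= (2 * q ^+ 2 * s + 2) * e.
Proof.
move=> E h1 h2; have h3 := ler_wpM2l (sqr_ge0 q) h1.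
have -> : q * x + a = q * (x - y) + (a - b) by rewrite mulrBr E; ring.
have := sqr_ge0 (q * (x - y) - (a - b)); lra.
Qed.

Let CS := cauchy_schwarz oOm mw w0.

Lemma ip_flux_sub f u e : L2 (wflux w f) -> L2 u -> sq (fun z => g z - wflux w f z) <= e ->
  (ip g u - ip (wflux w f) u) ^+ 2 <= e * sq u.
Proof.
move=> Lf Lu h; have Ld := L2B oOm mw w0 L2_flux Lf.
rewrite -(ipBl oOm mw w0 L2_flux Lf Lu); apply: le_trans (CS Ld Lu) _.
by rewrite ler_wpM2r//; exact: ip_ge0.
Qed.

Lemma flux_orthogonal h : A2w Om w h -> ip g h = 0.
Proof.
(* Orthogonality is first shown against holomorphic functions, then extended to their closure by
   Cauchy-Schwarz. *)
have holo k : holomorphic Om k -> L2 k -> ip g k = 0.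
  move=> hk Lk; apply: (@sqr_small_eq0 _ (sq k)) => e e0 e1.
  have [f [tf Lf hf _]] := flux_approx e0 e1.
  have := ip_flux_sub Lf Lk hf; rewrite (ip_flux_test_holomorphic tf Lf hk Lk) subr0.
  by move=> /le_trans; apply; rewrite mulrC.
move=> Ah; have Lh := A2_L2 Ah; apply: (@sqr_small_eq0 _ (sq g)) => e e0 e1.
have [k [hk Lk kh]] := A2_approx oOm mw w0 Ah e0.
have := CS L2_flux (L2B oOm mw w0 Lh Lk); rewrite (ipBr oOm mw w0 Lh Lk L2_flux) (holo k hk Lk) subr0.
by move=> /le_trans; apply; rewrite ler_wpM2l ?ip_ge0// ltW.
Qed.

Lemma ip_flux_conj : L2 (fun z => z^*%C) -> pi * ip g (fun z => z^*%C) = - re_integral v.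
Proof.
move=> Lc; apply/eqP; rewrite -addr_eq0; apply/eqP.
apply: (@sqr_small_eq0 _ (2 * pi ^+ 2 * sq (fun z => z^*%C) + 2)) => e e0 e1.
have [f [tf Lf hf hv]] := flux_approx e0 e1.
have E : pi * ip (wflux w f) (fun z => z^*%C) = - re_integral f.
  rewrite (ip_flux_test tf Lf Lc) (@test_integral f (fun z => z^*%C) 1 tf) ?mulN1r// => z _.
  by have := cdiffJ (cdiff_id z); rewrite rmorph1; eexists; eassumption.
exact: (approx_relation E (ip_flux_sub Lf Lc hf) (sqr_le_small (ltW e1) hv)).
Qed.

(** Green's formula is tested on the flux itself, whose delbar is -1/2; just one of the two
    arguments of the inner product is approximated. *)
Lemma sq_flux : 2 * pi * sq g = re_integral v.
Proof.
apply/eqP; rewrite -subr_eq0; apply/eqP.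
apply: (@sqr_small_eq0 _ (2 * (2 * pi) ^+ 2 * sq g + 2)) => e e0 e1.
have [f [tf Lf hf hv]] := flux_approx e0 e1.
have E : 2 * pi * ip (wflux w f) g = re_integral f.
  rewrite -mulrA (ip_flux_test tf Lf L2_flux).
  rewrite (@test_integral f g (- 2^-1) tf); first by rewrite opprK mulrA divff ?mul1r ?pnatr_eq0.
  move=> z oz; exists (del g z).
  by have := class_C1_cdiff oOm cg oz; rewrite delbar_flux// rmorphN fmorphV rmorph_nat.
apply: (@approx_relation _ _ _ _ (- re_integral v) (- re_integral f) _ _ (ip_flux_sub Lf L2_flux hf)).
  by rewrite opprK.
by rewrite -opprD sqrrN; exact: (sqr_le_small (ltW e1) hv).
Qed.

End energy.

(** * The lower bound by the torsional rigidity *)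

Section rigidity.
Variables (R : realType) (Om : set R[i]^o) (w : R[i]^o -> R) (M : R) (v : R[i]^o -> R[i]^o).
Local Notation leb2 := ((@lebesgue_measure R) \x (@lebesgue_measure R))%E.
Local Notation RR := (measurableTypeR R * measurableTypeR R)%type.
Local Notation D := (@of_xy R @^-1` Om).
Hypothesis oOm : open Om.
Hypothesis mw : measurable_fun D (fun p : RR => w (of_xy p)).
Hypothesis w0 : forall z, Om z -> 0 <= w z.
Hypothesis OmM : forall z, Om z -> cmod z <= M.
Hypothesis v_sol : dirichlet_solution Om w v.
Local Notation L2 := (L2w Om w).
Local Notation ip := (ip Om w).
Local Notation sq f := (ip f f).
Local Notation g := (wflux w v).

Lemma area_weight : area_integral Om (fun z => (w z)%:E) = (pi%:E * wnorm2 Om w (fun=> 1%R))%E.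
Proof.
have pi0 : 0 < pi :> R by exact: pi_gt0.
rewrite /wnorm2 /area_integral -ge0_integralZl//.
- apply: eq_integral => p _; rewrite -EFinM; congr EFin.
  by rewrite (cmodR 1) normr1 expr1n mul1r mulrC divfK// gt_eqF.
- exact: (open_measurable_xy oOm).
- apply/measurable_EFinP; apply: measurable_funM; first exact: measurable_cst.
  by apply: measurable_funM => //; exact: measurable_cst.
- by move=> p Dp; rewrite lee_fin mulr_ge0 ?sqr_ge0// (wpi_ge0 w0).
- by rewrite lee_fin ltW.
Qed.

Lemma torsional_rigidityE : torsional_rigidity Om v = 2 * re_integral Om v.
Proof. by []. Qed.

Lemma L2_cst1 r : area_integral Om (fun z => (w z)%:E) = r%:E ->
  L2 (fun=> 1) /\ pi * sq (fun=> 1) = r.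
Proof.
have pi0 : 0 < pi :> R by exact: pi_gt0.
move=> Er; have L1 : L2 (fun=> 1).
  have [m1 m2] := cmeas_cst Om (1 : R[i]^o); split=> //; rewrite ltey; apply/negP => /eqP h.
  by move: Er; rewrite area_weight h mulry gtr0_sg// mul1e.
by split=> //; move: Er; rewrite area_weight (wnorm2E oOm mw w0 L1) -EFinM => -[].
Qed.

Lemma rigidity_bound : ((torsional_rigidity Om v)%:E / area_integral Om (fun z => (w z)%:E)
   <= A2opnorm Om w (self_commutator Om w (toeplitz Om w id)))%E.
Proof.
rewrite torsional_rigidityE; have pi0 : 0 < pi :> R by exact: pi_gt0.
have Lg := L2_flux oOm mw w0 OmM v_sol; have sqE := sq_flux oOm mw w0 OmM v_sol.
set V := re_integral Om v in sqE *.
have op0 := A2opnorm_ge0 oOm mw w0 (self_commutator Om w (toeplitz Om w id)).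
have [->|Vn] := eqVneq V 0; first by rewrite mulr0 mul0e.
have V0 : 0 < V.
  by rewrite lt_neqAle eq_sym Vn -sqE mulr_ge0 ?ip_ge0// mulr_ge0 ?ltW// ltr0n.
case Er : (area_integral Om (fun z => (w z)%:E)) => [r||]; last 2 first.
(* If [w] has infinite integral, the quotient is 0 and the bound is [op0]. *)
- by rewrite invey mule0.
- have : (0 <= area_integral Om (fun z => (w z)%:E))%E.
    by apply: integral_ge0 => p Dp; rewrite lee_fin w0.
  by rewrite Er.
have [L1 sq1] := L2_cst1 Er.
have Lc : L2 (fun z => z^*%C).
  apply: (L2_le oOm mw w0 (cmeas_conj oOm) L1 (C := M ^+ 2)) => z oz.
  rewrite (cmodR 1) normr1 expr1n mulr1 cmodJ.
  by rewrite lerXn2r ?nnegrE ?cmod_ge0 ?OmM// (le_trans (cmod_ge0 z) (OmM oz)).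
have E := ip_flux_conj oOm mw w0 OmM v_sol Lc.
have rn : r != 0.
  (* If the total weight were zero, Cauchy-Schwarz applied to z g and 1 would make the pairing of
     [g] with conj z vanish, against V > 0. *)
  apply/eqP => r0; have sq10 : sq (fun=> 1) = 0.
    by apply: (mulfI (lt0r_neq0 pi0)); rewrite sq1 r0 mulr0.
  have Lzg := L2M oOm mw w0 (cmeas_cont oOm (fun z _ => cdiff_cont (cdiff_id z))) OmM Lg.
  have := cauchy_schwarz oOm mw w0 Lzg L1; rewrite sq10 mulr0 ip_mul.
  rewrite (@eq_ip _ _ w _ _ g (fun z => z^*%C)) => [h|//|z _]; last by rewrite mulr1.
  have ip0 : ip g (fun z => z^*%C) = 0 by apply/eqP; rewrite -sqrf_eq0 eq_le h sqr_ge0.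
  by move: E V0; rewrite ip0 mulr0 => /eqP; rewrite eq_sym oppr_eq0 => /eqP; rewrite -/V => ->; rewrite ltxx.
have r0 : 0 < r by rewrite lt_neqAle eq_sym rn -sq1 mulr_ge0 ?ip_ge0// ltW.
(* This [c] gives the constant function norm 1, since the squared norm of 1 is r / pi. *)
pose c := Num.sqrt (pi / r).
have c2 : c ^+ 2 = pi / r by rewrite sqr_sqrtr// divr_ge0 ?ltW.
have Lk : L2 (fun=> c%:C * 1) := L2Z oOm mw w0 c%:C L1.
have sqk : sq (fun=> c%:C * 1) = 1.
  rewrite (ipZl oOm mw w0 c L1 Lk) (ipC _ _ (fun=> 1)) (ipZl oOm mw w0 c L1 L1) mulrA -expr2 c2.
  by rewrite mulrC mulrA (mulrC _ pi) sq1 divff.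
have hk : holomorphic Om (fun=> c%:C * 1 : R[i]^o) by exact (@holomorphic_cst R Om (c%:C * 1)).
have [r' r'op] := self_commutator_lower_bound oOm mw w0 OmM (A2_holomorphic oOm mw w0 hk Lk) sqk Lg
  (fun h => @flux_orthogonal _ _ _ _ _ oOm mw w0 OmM v_sol h).
rewrite (@eq_ip _ _ w _ _ g (fun z => c%:C * z^*%C)) => [|//|z _]; last by rewrite mulr1 mulrC.
rewrite (ipC _ _ g) (ipZl oOm mw w0 c Lc Lg) (ipC _ _ _ g) exprMn c2 => hr.
apply: le_trans r'op; rewrite inver (negPf rn) -EFinM lee_fin.
move: (ip g _) (sq g) E sqE hr => x y E sqE hr.
(* Multiplied by 2 pi r, the bound [hr] involves just pi x = - V and 2 pi y = V; it reads 2 V^2 <= V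
   r' r, and dividing by V > 0 concludes. *)
have h : 2 * (pi * x) ^+ 2 <= 2 * pi * y * r' * r.
  have := ler_wpM2l (ltW (mulr_gt0 (mulr_gt0 (ltr0n R 2) pi0) r0)) hr.
  by move: (pi : R) => q; rewrite (_ : 2 * q * r * (q / r * x ^+ 2) = 2 * (q * x) ^+ 2); [lra|field].
rewrite ler_pdivrMr// -(ler_pM2l V0); move: h; rewrite E sqE -/V sqrrN; lra.
Qed.

End rigidity.

(* When w is not integrable on Omega, the quotient by +oo is 0. *)
Theorem proposition1 (R : realType) (Omega : set R[i]^o)
    (phi v : R[i]^o -> R[i]^o) (alpha : R)
    (Omega_bounded : bounded_set Omega)
    (Omega_domain : is_domain Omega)
    (Omega_sc : simply_connected Omega)
    (phi_riemann : is_riemann_map Omega phi)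
    (alpha_gt : -1 < alpha) (alpha_lt : alpha < 0)
    (v_sol : dirichlet_solution Omega (weight alpha phi) v) :
  let w := weight alpha phi in
  ((torsional_rigidity Omega v)%:E
     / area_integral Omega (fun z => (w z)%:E)
   <= A2opnorm Omega w (self_commutator Omega w (toeplitz Omega w id)))%E.
Proof.
have [_ oOm _] := Omega_domain; have [hphi _ _] := phi_riemann.
have [M OmM] := bounded_cmod Omega_bounded.
exact (rigidity_bound oOm (measurable_weight alpha oOm hphi)
  (fun z _ => weight_ge0 phi z alpha_gt) OmM v_sol).
Qed.
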